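(* Let $F$ be a $2$-adic field (so $p=2$). The Weil representation $\omega_{\psi,X}$ of $\mathrm{Mp}(W)$ can be realised over $\mathcal{L}=\mathcal{K}^{G_{2'}}$, i.e. there exists a smooth representation $\mathcal{V}$ of $\mathrm{Mp}(W)$ over $\mathcal{L}$ such that $\mathcal{V}\otimes_{\mathcal{L}}\mathcal{K}\simeq\omega_{\psi,X}$.
   Context: $F$ is a finite extension of $\mathbb{Q}_2$. $R_0$ is $\mathbb{Q}$ or $\mathbb{F}_\ell$ with $\ell\neq2$. $\mathcal{K}=R_0[\zeta_{2^\infty}]=\bigcup_kR_0[\zeta_{2^k}]$; its Galois group $\mathrm{Gal}(\mathcal{K}/R_0)$ is identified, via the cyclotomic character, with an open subgroup of $\mathbb{Z}_2^\times$. Set $G_{2'}=\mathbb{Z}_2^{\times2}\cap\mathrm{Gal}(\mathcal{K}/R_0)$, where $\mathbb{Z}_2^{\times2}=1+8\mathbb{Z}_2$, and $\mathcal{L}=\mathcal{K}^{G_{2'}}$ (an extension of $R_0$ of degree $1$, $2$ or $4$; equal to $\mathbb{Q}[\zeta_8]$ when $R_0=\mathbb{Q}$). $\psi:F\to\mathcal{K}^\times$ is a non-trivial smooth character. Weil representation. Let $(W,\langle\ ,\ \rangle)$ be a nonzero symplectic $F$-vector space with a complete polarisation $W=X\oplus Y$ (transverse Lagrangians). The Heisenberg group is $H=W\times F$ with law $(w,t)(w',t')=(w+w',t+t'+\frac12\langle w,w'\rangle)$; $\mathrm{Sp}(W)$ acts by $g\cdot(w,t)=(gw,t)$. The Heisenberg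 representation $\rho_\psi$ is realised on $C_c^\infty(Y,\mathcal{K})$ by $\rho_\psi(x+y,t)f(y')=\psi(t)\psi(\langle y',x\rangle+\frac12\langle y,x\rangle)f(y'+y)$. The metaplectic group $\mathrm{Mp}(W)=\mathrm{Sp}(W)\times_{c_X}\{\pm1\}$ ($c_X$ the metaplectic cocycle) is, up to isomorphism, the non-trivial topological double cover of $\mathrm{Sp}(W)$. The Weil representation $\omega_{\psi,X}$ is the smooth representation of $\mathrm{Mp}(W)$ on $C_c^\infty(Y,\mathcal{K})$ characterised by: the central element $-1$ acts by $-1$; $\omega_{\psi,X}(\tilde g)\rho_\psi(h)\omega_{\psi,X}(\tilde g)^{-1}=\rho_\psi(g\cdot h)$ for $\tilde g$ above $g\in\mathrm{Sp}(W)$ and $h\in H$; and $(n,1)$ above $n\in N(X)$ (unipotent radical of the stabiliser of $X$, which lifts to $\mathrm{Mp}(W)$) acts by $f(y)\mapsto\psi(\frac12\langle by,y\rangle)f(y)$ with $b=(n-\mathrm{id}_W)|_Y:Y\to X$. *)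

(* Defs.v *)
From HB Require Import structures.
From mathcomp Require Import all_boot all_order all_algebra all_field sesquilinear.
From mathcomp Require Import all_classical topology.
From mathcomp Require Import ring.

Set Implicit Arguments.
Unset Strict Implicit.
Unset Printing Implicit Defensive.

Import GRing.Theory.
Local Open Scope classical_set_scope.
Local Open Scope ring_scope.

Definition Z2prod : Type := forall n, 'Z_(2 ^ n.+1).
HB.instance Definition _ := Choice.copy Z2prod (forall n, 'Z_(2 ^ n.+1)).
Section Z2prodRing.
Implicit Types x y z : Z2prod.
Definition z2p_zero : Z2prod := fun n => 0.
Definition z2p_one : Z2prod := fun n => 1.
Definition z2p_opp x : Z2prod := fun n => - x n.
Definition z2p_add x y : Z2prod := fun n => x n + y n.
Definition z2p_mul x y : Z2prod := fun n => x n * y n.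
Lemma z2p_ext x y : (forall n, x n = y n) -> x = y.
Proof. by move=> e; apply: functional_extensionality_dep. Qed.
Lemma z2p_addA : associative z2p_add.
Proof. by move=> x y z; apply: z2p_ext => n; apply: addrA. Qed.
Lemma z2p_addC : commutative z2p_add.
Proof. by move=> x y; apply: z2p_ext => n; apply: addrC. Qed.
Lemma z2p_add0 : left_id z2p_zero z2p_add.
Proof. by move=> x; apply: z2p_ext => n; apply: add0r. Qed.
Lemma z2p_addN : left_inverse z2p_zero z2p_opp z2p_add.
Proof. by move=> x; apply: z2p_ext => n; apply: addNr. Qed.
Lemma z2p_mulA : associative z2p_mul.
Proof. by move=> x y z; apply: z2p_ext => n; apply: mulrA. Qed.
Lemma z2p_mulC : commutative z2p_mul.
Proof. by move=> x y; apply: z2p_ext => n; apply: mulrC. Qed.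
Lemma z2p_mul1 : left_id z2p_one z2p_mul.
Proof. by move=> x; apply: z2p_ext => n; apply: mul1r. Qed.
Lemma z2p_mulDl : left_distributive z2p_mul z2p_add.
Proof. by move=> x y z; apply: z2p_ext => n; apply: mulrDl. Qed.
Lemma z2p_1neq0 : z2p_one != z2p_zero.
Proof. by apply/eqP => /(congr1 (fun x : Z2prod => x 0%N))/eqP. Qed.
HB.instance Definition _ := GRing.isZmodule.Build Z2prod
  z2p_addA z2p_addC z2p_add0 z2p_addN.
HB.instance Definition _ := GRing.Zmodule_isComNzRing.Build Z2prod
  z2p_mulA z2p_mulC z2p_mul1 z2p_mulDl z2p_1neq0.
End Z2prodRing.

(* Z_2 is the inverse limit of the Z/2^(n+1), n : nat *)
Definition z2_compat : {pred Z2prod} :=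
  fun x => `[< forall n, x n = (x n.+1 : nat)%:R >].

Lemma pow2_gt1 n : (1 < 2 ^ n.+1)%N.
Proof. by rewrite -{1}(expn0 2) ltn_exp2l. Qed.

Lemma Z2_red_nat m n k : (m <= n)%N -> (k %% 2 ^ n.+1)%:R = k%:R :> 'Z_(2 ^ m.+1).
Proof.
move=> mn; rewrite -[RHS]Zp_nat_mod ?pow2_gt1 // -[LHS]Zp_nat_mod ?pow2_gt1 //.
by rewrite modn_dvdm // dvdn_exp2l.
Qed.

Lemma val_ZpD n (a b : 'Z_(2 ^ n.+1)) : (a + b)%R = ((a + b)%N %% 2 ^ n.+1)%N :> nat.
Proof. by congr (_ %% _)%N; apply: Zp_cast; apply: pow2_gt1. Qed.
Lemma val_ZpM n (a b : 'Z_(2 ^ n.+1)) : (a * b)%R = ((a * b)%N %% 2 ^ n.+1)%N :> nat.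
Proof. by congr (_ %% _)%N; apply: Zp_cast; apply: pow2_gt1. Qed.

Lemma z2_compat_subring : subring_closed z2_compat.
Proof.
have redM n (a b : 'Z_(2 ^ n.+2)) :
    (nat_of_ord (a * b))%:R = (a : nat)%:R * (b : nat)%:R :> 'Z_(2 ^ n.+1).
  by rewrite val_ZpM Z2_red_nat // natrM.
have redD n (a b : 'Z_(2 ^ n.+2)) :
    (nat_of_ord (a + b))%:R = (a : nat)%:R + (b : nat)%:R :> 'Z_(2 ^ n.+1).
  by rewrite val_ZpD Z2_red_nat // natrD.
have red1 n : (nat_of_ord (1%R : 'Z_(2 ^ n.+2)))%:R = 1 :> 'Z_(2 ^ n.+1).
  by [].
have compat_sub x y : x \in z2_compat -> y \in z2_compat -> x - y \in z2_compat.
  move=> /asboolP hx /asboolP hy; apply/asboolP => n.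
  have -> : (x - y) n = x n - y n by [].
  have -> : (x - y) n.+1 = x n.+1 - y n.+1 by [].
  rewrite {1}hx {1}hy; apply/eqP; rewrite subr_eq; apply/eqP.
  by rewrite -redD subrK.
split=> //.
- by apply/asboolP => n.
- move=> x y /asboolP hx /asboolP hy; apply/asboolP => n.
  have -> : (x * y) n = x n * y n by [].
  have -> : (x * y) n.+1 = x n.+1 * y n.+1 by [].
  by rewrite {1}hx {1}hy redM.
Qed.
HB.instance Definition _ := GRing.isSubringClosed.Build Z2prod z2_compat z2_compat_subring.

Record Z2 := MkZ2 { z2val : Z2prod ; z2valP : z2val \in z2_compat }.
HB.instance Definition _ := [isSub for z2val].
HB.instance Definition _ := [Choice of Z2 by <:].
HB.instance Definition _ := [SubChoice_isSubComNzRing of Z2 by <:].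

Definition z2_unit : pred Z2 := fun x => `[< exists y, y * x = 1 >].
Definition z2_inv (x : Z2) : Z2 :=
  if pselect (exists y, y * x = 1) is left h then projT1 (cid h) else x.
Lemma z2_mulV : {in z2_unit, left_inverse 1 z2_inv *%R}.
Proof. by move=> x /asboolP h; rewrite /z2_inv; case: pselect => // {}h; case: (cid h). Qed.
Lemma z2_unitP (x y : Z2) : y * x = 1 -> z2_unit x.
Proof. by move=> h; apply/asboolP; exists y. Qed.
Lemma z2_inv_out : {in [predC z2_unit], z2_inv =1 id}.
Proof. by move=> x /asboolP h; rewrite /z2_inv; case: pselect. Qed.
HB.instance Definition _ := GRing.ComNzRing_hasMulInverse.Build Z2 z2_mulV z2_unitP z2_inv_out.

Lemma z2_valM (x y : Z2) n : val (x * y) n = val x n * val y n.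
Proof. by []. Qed.

Lemma z2_red (x : Z2) m n : (m <= n)%N -> val x m = (val x n : nat)%:R.
Proof.
move=> /subnKC <-; elim: (n - m)%N => [|k IH]; first by rewrite addn0 natr_Zp.
rewrite IH; case: x {IH} => x /= /asboolP hx; rewrite addnS hx.
by rewrite val_Zp_nat ?pow2_gt1 // Z2_red_nat // leq_addr.
Qed.

Lemma z2_mod (x : Z2) m n : (m <= n)%N -> (val x m : nat) = (val x n %% 2 ^ m.+1)%N.
Proof. by move=> mn; rewrite (z2_red x mn) val_Zp_nat ?pow2_gt1. Qed.

Lemma z2_lt (x : Z2) n : (val x n < 2 ^ n.+1)%N.
Proof. have := ltn_ord (val x n); rewrite [X in (_ < X)%N -> _]Zp_cast //; apply: pow2_gt1. Qed.

Lemma z2_neq0 (x : Z2) : x != 0 -> exists n, ~~ (2 ^ n.+1 %| val x n)%N.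
Proof.
move=> x0; apply/not_existsP => h; case/eqP: x0; apply/val_inj/z2p_ext => n.
have /negP := h n; rewrite negbK /dvdn (modn_small (z2_lt x n)) => /eqP hn.
exact: val_inj.
Qed.

Lemma z2_logn (x : Z2) n : ~~ (2 ^ n.+1 %| val x n)%N ->
  forall m, (n <= m)%N -> (0 < val x m)%N /\ (logn 2 (val x m) <= n)%N.
Proof.
move=> hn m nm; have := hn; rewrite (z2_mod x nm) /dvdn modn_mod.
move=> hm; have x0 : (0 < val x m)%N.
  by rewrite lt0n; apply: contraNneq hm => ->; rewrite mod0n.
split=> //; rewrite leqNgt; apply: contra hm => hl.
by rewrite -/(dvdn _ _) (pfactor_dvdn _ _ x0).
Qed.

Lemma z2_domain : GRing.integral_domain_axiom Z2.
Proof.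
move=> x y xy0; apply/norP => -[x0 y0].
have [n /z2_logn hn] := z2_neq0 x0; have [m /z2_logn hm] := z2_neq0 y0.
have [xp xl] := hn (n + m)%N (leq_addr _ _).
have [yp yl] := hm (n + m)%N (leq_addl _ _).
have /(congr1 (fun z : Z2 => val z (n + m)%N)) := xy0.
rewrite z2_valM => /(congr1 (@nat_of_ord _)).
have -> : nat_of_ord (val (0 : Z2) (n + m)%N) = 0%N by [].
rewrite val_ZpM => /eqP; rewrite -/(dvdn _ _) pfactor_dvdn ?muln_gt0 ?xp //.
by rewrite lognM // ltnNge leq_add.
Qed.
HB.instance Definition _ := GRing.ComUnitRing_isIntegral.Build Z2 z2_domain.

Definition Q2 : Type := {fraction Z2}.
HB.instance Definition _ := GRing.Field.on Q2.

Lemma z2_redM n (a b : 'Z_(2 ^ n.+2)) :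
  (nat_of_ord (a * b))%:R = (a : nat)%:R * (b : nat)%:R :> 'Z_(2 ^ n.+1).
Proof. by rewrite val_ZpM Z2_red_nat // natrM. Qed.

Lemma z2_pow2_multiple (z : Z2) : z != 0 -> exists j w, z * w = 2 ^+ j.
Proof.
move=> /z2_neq0; pose P n := ~~ (2 ^ n.+1 %| val z n)%N => -[n0 Pn0].
have exP : exists n, P n by exists n0.
case: (ex_minnP exP) => j Pj jmin {n0 Pn0 exP}.
have dvdj n : (2 ^ j %| val z (n + j))%N.
  case: j Pj jmin => [|j] Pj jmin; first exact: dvd1n.
  have : ~~ P j by apply/negP => /jmin; rewrite ltnn.
  by rewrite /P negbK (z2_mod z (_ : (j <= n + j.+1)%N)) ?addnS ?leqW ?leq_addl //
     /dvdn modn_mod.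
pose u n := (val z (n + j) %/ 2 ^ j)%N.
have uE n : (val z (n + j) : nat) = (u n * 2 ^ j)%N by rewrite divnK.
have u_odd n : coprime (2 ^ n.+1) (u n).
  rewrite coprimeXl // prime_coprime //; apply: contra Pj => hu.
  rewrite (z2_mod z (leq_addl n j)) /dvdn modn_mod uE -/(dvdn _ _).
  by rewrite expnS dvdn_pmul2r // expn_gt0.
have u_red n : ((u n.+1)%:R : 'Z_(2 ^ n.+1)) = (u n)%:R.
  rewrite -(Z2_red_nat (u n.+1) (leqnn n)); congr (_%:R).
  apply/eqP; rewrite -(eqn_pmul2r (_ : 0 < 2 ^ j)%N) ?expn_gt0 // muln_modl.
  by rewrite -expnD addSn -!uE -z2_mod // leq_add2r.
have u_unit n : ((u n)%:R : 'Z_(2 ^ n.+1)) \is a GRing.unit.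
  by rewrite unitZpE ?pow2_gt1 // u_odd.
pose w : Z2prod := fun n => (u n)%:R^-1.
have wP : w \in z2_compat.
  apply/asboolP => n; apply: (mulrI (u_unit n)); rewrite (divrr (u_unit n)).
  have := divrr (u_unit n.+1) => /(congr1 (fun a => (nat_of_ord a)%:R : 'Z_(2 ^ n.+1))).
  by rewrite z2_redM val_Zp_nat ?pow2_gt1 // Z2_red_nat // u_red.
exists j, (MkZ2 wP); apply/val_inj/z2p_ext => n.
have -> : val (z * MkZ2 wP) n = val z n * w n by [].
rewrite (z2_red z (leq_addr j n)) uE natrM mulrAC /w (divrr (u_unit n)) mul1r natrX.
elim: j {Pj jmin dvdj u uE u_odd u_red u_unit w wP} => [|j IH]; first by rewrite !expr0.
by rewrite !exprS IH.
Qed.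

HB.mixin Record isTopField k & GRing.Field k & Topological k := {
  addk_continuous : continuous (fun z : k * k => z.1 + z.2);
  mulk_continuous : continuous (fun z : k * k => z.1 * z.2) }.

(* Continuity of the inverse is not required: only sums and products are used
   to topologise vector spaces. *)
#[short(type="topFieldType")]
HB.structure Definition TopField :=
  {k of GRing.Field k & Topological k & isTopField k}.

(* a fundamental system of neighbourhoods of x is given by the x + 2^n Z_2 *)
Definition Q2_nbhs (x : Q2) : set_system Q2 :=
  filter_from [set: nat] (fun n => [set x + 2 ^+ n * tofrac z | z in [set: Z2]]).

HB.instance Definition _ := hasNbhs.Build Q2 Q2_nbhs.

Lemma Q2_nbhsP (x : Q2) (A : set Q2) :
  nbhs x A <-> exists n, forall z : Z2, A (x + 2 ^+ n * tofrac z).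
Proof.
split=> [[n _ nA]|[n nA]]; first by exists n => z; apply: nA; exists z.
by exists n => // _ [z _ <-].
Qed.

Lemma Q2_nbhs_filter (x : Q2) : ProperFilter (nbhs x).
Proof.
apply: (filter_from_proper (filter_from_filter _ _)) => [|n m _ _|n _].
- by exists 0%N.
- exists (n + m)%N => // _ [z _ <-]; split.
    by exists (2 ^+ m * z) => //; rewrite rmorphM rmorphXn rmorph_nat mulrA exprD.
  exists (2 ^+ n * z) => //.
  by rewrite rmorphM rmorphXn rmorph_nat mulrA -exprD addnC exprD.
- by exists x; exists 0 => //; rewrite rmorph0 mulr0 addr0.
Qed.

Lemma Q2_nbhs_singleton (x : Q2) (A : set Q2) : nbhs x A -> A x.
Proof. by move=> /Q2_nbhsP[n /(_ 0)]; rewrite rmorph0 mulr0 addr0. Qed.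

Lemma Q2_nbhs_nbhs (x : Q2) (A : set Q2) : nbhs x A -> nbhs x (nbhs^~ A).
Proof.
move=> /Q2_nbhsP[n nA]; apply/Q2_nbhsP; exists n => z; apply/Q2_nbhsP.
by exists n => t; rewrite -addrA -mulrDr -rmorphD; apply: nA.
Qed.

HB.instance Definition _ := Nbhs_isNbhsTopological.Build Q2
  Q2_nbhs_filter Q2_nbhs_singleton Q2_nbhs_nbhs.

Lemma continuous2P (T U V : topologicalType) (f : T * U -> V) :
  (forall x y A, nbhs (f (x, y)) A -> exists P Q,
    [/\ nbhs x P, nbhs y Q & forall a b, P a -> Q b -> A (f (a, b))]) ->
  continuous f.
Proof.
move=> h [x y] A /h[P [Q [xP yQ PQ]]].
by rewrite /nbhs /=; exists (P, Q) => // -[a b] [/=]; apply: PQ.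
Qed.

Lemma Q2_addc : continuous (fun z : Q2 * Q2 => z.1 + z.2).
Proof.
apply: continuous2P => x y A /Q2_nbhsP[n nA].
exists [set x + 2 ^+ n * tofrac z | z in setT], [set y + 2 ^+ n * tofrac z | z in setT].
split; [by exists n|by exists n|move=> _ _ [z _ <-] [t _ <-] /=].
by rewrite addrACA -mulrDr -rmorphD; apply: nA.
Qed.

Lemma Q2_denom (x : Q2) : exists j w, 2 ^+ j * x = tofrac w.
Proof.
have [p [q q0 xE]] : exists p, exists2 q : Z2, q != 0 & tofrac q * x = tofrac p.
  elim/quotW: x => r; exists (frac r).1, (frac r).2; first exact: denom_ratioP.
  unlock tofrac; rewrite -[LHS]FracField.pi_mul.
  apply/eqmodP; rewrite /= FracField.equivfE /FracField.mulf.
  by rewrite !numden_Ratio ?oner_eq0 ?mul1r ?mulr1 ?denom_ratioP // mulrC.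
have [j [w wE]] := z2_pow2_multiple q0; exists j, (w * p).
have e : tofrac (q * w) = 2 ^+ j by rewrite wE rmorphXn rmorph_nat.
by rewrite -e !tofracM -xE mulrA [tofrac q * _]mulrC.
Qed.

Lemma Q2_mulc : continuous (fun z : Q2 * Q2 => z.1 * z.2).
Proof.
apply: continuous2P => x y A /Q2_nbhsP[n nA].
have [i [p pE]] := Q2_denom x; have [j [q qE]] := Q2_denom y.
exists [set x + 2 ^+ (n + j) * tofrac z | z in setT],
       [set y + 2 ^+ (n + i) * tofrac z | z in setT].
split; [by exists (n + j)%N|by exists (n + i)%N|move=> _ _ [z _ <-] [t _ <-] /=].
have := nA (p * t + q * z + 2 ^+ (n + i + j) * (z * t)).
have e : tofrac (2 ^+ (n + i + j) : Z2) = 2 ^+ (n + i + j).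
  by rewrite rmorphXn rmorph_nat.
rewrite !tofracD !tofracM e -pE -qE => h.
rewrite (_ : _ * _ = x * y + 2 ^+ n * (2 ^+ i * x * tofrac t +
  2 ^+ j * y * tofrac z + 2 ^+ (n + i + j) * (tofrac z * tofrac t))) //.
by rewrite !exprD; ring.
Qed.

HB.instance Definition _ := isTopField.Build Q2 Q2_addc Q2_mulc.

Section VectorTopology.
Variable k : topFieldType.

(* The usual topology of a finite-dimensional space: the product topology in
   coordinates, which does not depend on the basis. *)
Definition vtop (V : vectType k) : topologicalType :=
  initial_topology (passmx.rVof (vbasis {:V}) : V -> 'rV[k]_(\dim {:V})).

Lemma vtop_nbhs (V : vectType k) (v : V) (A : set V) :
  nbhs (v : vtop V) A <-> exists2 P : 'I_(\dim {:V}) -> set k,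
    (forall i, nbhs (coord (vbasis {:V}) i v) (P i)) &
    (forall u, (forall i, P i (coord (vbasis {:V}) i u)) -> A u).
Proof.
split.
  rewrite nbhsE => -[B [[C oC <-] Cv] BA].
  have : nbhs (passmx.rVof (vbasis {:V}) v : 'rV[k]_(\dim {:V})) C.
    by apply: open_nbhs_nbhs; split.
  move=> [P vP PC]; exists (P 0) => [i|u hu].
    by rewrite passmx.coord_rVof; apply: vP.
  by apply: BA; apply: PC => i j; rewrite ord1 -passmx.coord_rVof.
move=> [P vP PA].
have h : nbhs (passmx.rVof (vbasis {:V}) v : 'rV[k]_(\dim {:V}))
    [set M | forall i, P i (M 0 i)].
  exists (fun _ => P) => [i j|M hM i]; last exact: hM.
  by rewrite ord1 -passmx.coord_rVof.
have : nbhs (v : vtop V) ((passmx.rVof (vbasis {:V}) : V -> 'rV[k]_(\dim {:V}))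
    @^-1` [set M | forall i, P i (M 0 i)]).
  exact: (@initial_continuous V _ (passmx.rVof (vbasis {:V})) v _ h).
by apply: filterS => u hu; apply: PA => i; rewrite passmx.coord_rVof.
Qed.

Lemma vtop_coord (V : vectType k) i :
  continuous (coord (vbasis {:V}) i : vtop V -> k).
Proof.
move=> v A vA; apply/vtop_nbhs.
exists (fun j => if j == i then A else setT) => [j|u /(_ i)]; last by rewrite eqxx.
by case: eqP => [->|_] //; apply: filterT.
Qed.

Lemma continuous_vtop (T : topologicalType) (V : vectType k) (f : T -> vtop V) :
  (forall i, continuous (fun t => coord (vbasis {:V}) i (f t) : k)) -> continuous f.
Proof.
move=> h t A /vtop_nbhs[P tP PA].
have : \forall s \near t, forall i, P i (coord (vbasis {:V}) i (f s)).
  by apply: filter_forall => i; apply: h.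
by apply: filterS => s; apply: PA.
Qed.

Lemma continuous_addk (T : topologicalType) (f g : T -> k) :
  continuous f -> continuous g -> continuous (fun t => f t + g t).
Proof.
move=> cf cg t.
apply: (@continuous_comp _ _ _ (fun t => (f t, g t)) (fun z => z.1 + z.2)).
  by apply: cvg_pair; [apply: cf|apply: cg].
exact: addk_continuous.
Qed.

Lemma continuous_mulk (T : topologicalType) (f g : T -> k) :
  continuous f -> continuous g -> continuous (fun t => f t * g t).
Proof.
move=> cf cg t.
apply: (@continuous_comp _ _ _ (fun t => (f t, g t)) (fun z => z.1 * z.2)).
  by apply: cvg_pair; [apply: cf|apply: cg].
exact: mulk_continuous.
Qed.

Lemma continuous_sumk (T : topologicalType) n (f : 'I_n -> T -> k) :
  (forall i, continuous (f i)) -> continuous (fun t => \sum_i f i t).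
Proof.
move=> cf; elim: n f cf => [|n IH] f cf.
  rewrite (_ : (fun _ => _) = fun=> 0); first exact: cst_continuous.
  by apply/funext => t; rewrite big_ord0.
rewrite (_ : (fun _ => _) = fun t => \sum_(i < n) f (widen_ord (leqnSn n) i) t + f ord_max t).
  by apply: continuous_addk => //; apply: IH.
by apply/funext => t; rewrite big_ord_recr.
Qed.

Lemma linear_continuous (V W : vectType k) (f : {linear V -> W}) :
  continuous (f : vtop V -> vtop W).
Proof.
apply: continuous_vtop => i.
rewrite (_ : (fun _ => _) = fun v => \sum_j coord (vbasis {:V}) j v *
   coord (vbasis {:W}) i (f (vbasis {:V})`_j)).
  apply: continuous_sumk => j; apply: continuous_mulk; first exact: vtop_coord.
  exact: cst_continuous.
apply/funext => v.
rewrite {1}(coord_vbasis (memvf v)) !linear_sum; apply: eq_bigr => j _.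
by rewrite !linearZ.
Qed.

Lemma vtop_addc (V : vectType k) : continuous (fun z : vtop V * vtop V => (z.1 : V) + z.2 : vtop V).
Proof.
apply: continuous_vtop => i.
rewrite (_ : (fun _ => _) = fun z : vtop V * vtop V =>
  coord (vbasis {:V}) i (z.1 : V) + coord (vbasis {:V}) i (z.2 : V)).
  apply: continuous_addk => z.
    apply: (@continuous_comp _ (vtop V) k fst (coord (vbasis {:V}) i : vtop V -> k)).
      exact: cvg_fst.
    exact: vtop_coord.
  apply: (@continuous_comp _ (vtop V) k snd (coord (vbasis {:V}) i : vtop V -> k)).
    exact: cvg_snd.
  exact: vtop_coord.
by apply/funext => z; rewrite linearD.
Qed.

Lemma vtop_translation (V : vectType k) (a : V) :
  continuous (fun v : vtop V => (v : V) + a : vtop V).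
Proof.
apply: continuous_vtop => i.
rewrite (_ : (fun _ => _) = fun v : vtop V =>
  coord (vbasis {:V}) i (v : V) + coord (vbasis {:V}) i a).
  apply: continuous_addk; first exact: vtop_coord.
  exact: cst_continuous.
by apply/funext => z; rewrite linearD.
Qed.

Lemma vtop_functional (V : vectType k) (l : {scalar V}) :
  continuous (l : vtop V -> k).
Proof.
rewrite (_ : (l : V -> k) = fun v =>
  \sum_j coord (vbasis {:V}) j v * l (vbasis {:V})`_j).
  apply: continuous_sumk => j; apply: continuous_mulk; first exact: vtop_coord.
  exact: cst_continuous.
apply/funext => v; rewrite {1}(coord_vbasis (memvf v)) linear_sum.
by apply: eq_bigr => j _; rewrite linearZ.
Qed.

End VectorTopology.

(* A finite extension F of Q_2 carries its topology of Q_2-vector space, which is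
   that of the absolute value extending the one of Q_2. *)
Definition adic (F : fieldExtType Q2) : Type := F.

Section Adic.
Variable F : fieldExtType Q2.
HB.instance Definition _ := GRing.Field.on (adic F).
HB.instance Definition _ := Topological.copy (adic F) (vtop F).

Lemma adic_addc : continuous (fun z : adic F * adic F => z.1 + z.2).
Proof. exact: (@vtop_addc Q2 F). Qed.

Lemma adic_mulc : continuous (fun z : adic F * adic F => z.1 * z.2).
Proof.
apply: (@continuous_vtop Q2 _ F) => i.
pose e := vbasis {:F}.
rewrite (_ : (fun _ => _) = fun z : vtop F * vtop F =>
  \sum_j \sum_l coord e j (z.1 : F) * (coord e l (z.2 : F) * coord e i (e`_j * e`_l : F))).
  apply: continuous_sumk => j; apply: continuous_sumk => l.
  apply: continuous_mulk.
    move=> z; apply: (@continuous_comp _ (vtop F) Q2 fst (coord e j : vtop F -> Q2)).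
      exact: cvg_fst.
    exact: vtop_coord.
  apply: continuous_mulk; last exact: cst_continuous.
  move=> z; apply: (@continuous_comp _ (vtop F) Q2 snd (coord e l : vtop F -> Q2)).
    exact: cvg_snd.
  exact: vtop_coord.
apply/funext => -[x y] /=.
rewrite {1}[x](coord_vbasis (memvf x)) {1}[y](coord_vbasis (memvf y)).
rewrite mulr_suml linear_sum; apply: eq_bigr => j _.
rewrite mulr_sumr linear_sum; apply: eq_bigr => l _.
by rewrite -scalerAl -scalerAr !linearZ.
Qed.
HB.instance Definition _ := isTopField.Build (adic F) adic_addc adic_mulc.
End Adic.

Definition locally_constant (T : topologicalType) (A : Type) (f : T -> A) :=
  forall x, \forall y \near x, f y = f x.

Section Schwartz.
Variables (k : topFieldType) (V : vectType k) (K : fieldType).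

Definition cc_pred : {pred V -> K^o} := fun f =>
  `[< locally_constant (f : vtop V -> K) /\
      compact (closure [set v : vtop V | f v != 0]) >].

Lemma cc_submod : submod_closed cc_pred.
Proof.
split.
  apply/asboolP; split; first by move=> x; near=> y.
  rewrite (_ : [set v | _] = set0) ?closure0; first exact: compact0.
  by apply/seteqP; split=> // v /=; rewrite eqxx.
move=> a f g /asboolP[fl fc] /asboolP[gl gc]; apply/asboolP; split.
  move=> x; near=> y.
  have -> : (a *: f + g) y = a * f y + g y by [].
  by congr (_ * _ + _); near: y; [exact: fl|exact: gl].
apply: (subclosed_compact _ (compactU fc gc)); first exact: closed_closure.
rewrite -closureU; apply: closure_subset => v /= h.
have [fv|fv] := eqVneq (f v : K) 0; last by left.
right; apply: contraNneq h => gv.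
have -> : (a *: f + g) v = a * f v + g v by [].
by rewrite fv gv mulr0 addr0.
Unshelve. all: by end_near. Qed.
HB.instance Definition _ := GRing.isSubmodClosed.Build K (V -> K^o) cc_pred cc_submod.

(* C_c^oo(V, K), for K discrete *)
Record Cc := MkCc { cc_fun :> V -> K^o ; _ : cc_fun \in cc_pred }.
HB.instance Definition _ := [isSub for cc_fun].
HB.instance Definition _ := [Choice of Cc by <:].
HB.instance Definition _ := [SubChoice_isSubLmodule of Cc by <:].
End Schwartz.

HB.mixin Record isTopGroup G & Group G & Topological G := {
  mulg_continuous : continuous (fun z : G * G => (z.1 * z.2)%g);
  invg_continuous : continuous (fun g : G => (g^-1)%g) }.

#[short(type="topGroupType")]
HB.structure Definition TopGroup := {G of Group G & Topological G & isTopGroup G}.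

Record rep (G : groupType) (k : fieldType) (V : lmodType k) := MkRep {
  rep_act :> G -> {linear V -> V};
  rep1 : forall v, rep_act 1%g v = v;
  repM : forall g h v, rep_act (g * h)%g v = rep_act g (rep_act h v) }.

Definition smooth_rep (G : topGroupType) (k : fieldType) (V : lmodType k)
  (r : rep G V) := forall v, open [set g | r g v = v].

Definition rep_iso (G : groupType) (k : fieldType) (V1 V2 : lmodType k)
    (r1 : rep G V1) (r2 : rep G V2) :=
  exists2 phi : {linear V1 -> V2}, bijective phi &
    forall g v, phi (r1 g v) = r2 g (phi v).

Section Symplectic.
Variables (F : topFieldType) (W : vectType F) (form : {skew_symmetric W}).

(* Injectivity is automatic for nondegenerate forms; it makes Sp a group for every
   form. *)
Record Sp := MkSp {
  sp_fun :> 'End(W);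
  _ : (lker sp_fun == 0%VS) && `[< isometry form form sp_fun >] }.
HB.instance Definition _ := [isSub for sp_fun].
HB.instance Definition _ := [Choice of Sp by <:].

Lemma sp_ker (g : Sp) : lker g == 0%VS. Proof. by case: g => g /= /andP[]. Qed.
Lemma sp_isom (g : Sp) : isometry form form g.
Proof. by case: g => g /= /andP[_ /asboolP]. Qed.

Fact sp_one_proof : (lker (\1%VF : 'End(W)) == 0%VS) &&
  `[< isometry form form (\1%VF : 'End(W)) >].
Proof.
apply/andP; split; last by apply/asboolP => u v; rewrite !id_lfunE.
by apply/lker0P => u v; rewrite !id_lfunE.
Qed.
Definition sp_one := MkSp sp_one_proof.

Fact sp_mul_proof (g h : Sp) : (lker (g \o h)%VF == 0%VS) &&
  `[< isometry form form (g \o h)%VF >].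
Proof.
apply/andP; split; last by apply/asboolP => u v; rewrite !comp_lfunE !sp_isom.
apply/lker0P => u v; rewrite !comp_lfunE => /(lker0P (sp_ker g)).
exact: (lker0P (sp_ker h)).
Qed.
Definition sp_mul g h := MkSp (sp_mul_proof g h).

Fact sp_inv_proof (g : Sp) : (lker (g^-1)%VF == 0%VS) &&
  `[< isometry form form (g^-1)%VF >].
Proof.
have gK u : g ((g^-1)%VF u) = u by rewrite lker0_lfunVK ?sp_ker.
apply/andP; split; last by apply/asboolP => u v; rewrite -(sp_isom g) !gK.
by apply/lker0P => u v /(congr1 g); rewrite !gK.
Qed.
Definition sp_inv g := MkSp (sp_inv_proof g).

Lemma sp_mulA : associative sp_mul.
Proof. by move=> x y z; apply/val_inj; rewrite /= comp_lfunA. Qed.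
Lemma sp_mul1 : left_id sp_one sp_mul.
Proof. by move=> x; apply/val_inj; rewrite /= comp_lfun1l. Qed.
Lemma sp_mul1r : right_id sp_one sp_mul.
Proof. by move=> x; apply/val_inj; rewrite /= comp_lfun1r. Qed.
Lemma sp_mulV : left_inverse sp_one sp_inv sp_mul.
Proof. by move=> x; apply/val_inj; rewrite /= lker0_compVf ?sp_ker. Qed.
Lemma sp_mulVr : right_inverse sp_one sp_inv sp_mul.
Proof. by move=> x; apply/val_inj; rewrite /= lker0_compfV ?sp_ker. Qed.
HB.instance Definition _ := isGroup.Build Sp sp_mulA sp_mul1 sp_mul1r sp_mulV sp_mulVr.

HB.instance Definition _ := Topological.copy Sp
  (initial_topology (fun g : Sp => sp_fun g : vtop 'End(W))).

Definition lagrangian (L : {vspace W}) := L == orthov form L.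

Definition polarisation (X Y : {vspace W}) :=
  [/\ lagrangian X, lagrangian Y, (X :&: Y = 0)%VS & (X + Y = fullv)%VS].

(* N(X): the isometries acting trivially on X and on W / X *)
Definition siegel_unipotent (X : {vspace W}) : set Sp :=
  [set n | (forall x, x \in X -> n x = x) /\ (forall w, n w - w \in X)].
End Symplectic.

Record smooth_char (F : topFieldType) (K : fieldType) := MkSmoothChar {
  char_fun :> F -> K;
  char_neq0 : forall x, char_fun x != 0;
  charD : forall x y, char_fun (x + y) = char_fun x * char_fun y;
  char_smooth : locally_constant char_fun }.

Section Heisenberg.
Variables (F : topFieldType) (W : vectType F) (form : {skew_symmetric W}).
Local Notation "''[' u , v ]" := (form u%R v%R) : ring_scope.

Definition Heis : Type := (W * F)%type.
HB.instance Definition _ := Choice.on Heis.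

Definition heis_one : Heis := (0, 0).
Definition heis_mul (h h' : Heis) : Heis :=
  (h.1 + h'.1, h.2 + h'.2 + 2^-1 * '[h.1, h'.1]).
(* This is (- w, - t), since '[w, w] = 0 when 2 != 0. *)
Definition heis_inv (h : Heis) : Heis := (- h.1, - h.2 + 2^-1 * '[h.1, h.1]).

Lemma heis_mulA : associative heis_mul.
Proof.
move=> [u r] [v s] [w t]; congr (_, _); rewrite /= ?addrA // linearDl linearDr /=.
by rewrite !mulrDr; ring.
Qed.
Lemma heis_mul1 : left_id heis_one heis_mul.
Proof. by move=> [u r]; rewrite /heis_mul /= linear0l mulr0 !add0r addr0. Qed.
Lemma heis_mul1r : right_id heis_one heis_mul.
Proof. by move=> [u r]; rewrite /heis_mul /= linear0r mulr0 !addr0. Qed.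
Lemma heis_mulV : left_inverse heis_one heis_inv heis_mul.
Proof.
move=> [u r]; rewrite /heis_mul /= linearNl addNr; congr (_, _).
by rewrite mulrN addrAC addrK addNr.
Qed.
Lemma heis_mulVr : right_inverse heis_one heis_inv heis_mul.
Proof.
move=> [u r]; rewrite /heis_mul /= linearNr subrr; congr (_, _).
by rewrite mulrN addrA addrK subrr.
Qed.
HB.instance Definition _ := isGroup.Build Heis
  heis_mulA heis_mul1 heis_mul1r heis_mulV heis_mulVr.

Definition sp_heis (g : Sp form) (h : Heis) : Heis := (g h.1, h.2).

Variables (K : fieldType) (psi : smooth_char F K) (X Y : {vspace W}).

Local Notation S := (Cc (subvs_of Y) K).

(* rho_psi(h) for h = (x + y, t) with x in X and y in Y *)
Definition heis_fun (h : Heis) (f : subvs_of Y -> K) : subvs_of Y -> K :=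
  let x := daddv_pi X Y h.1 in
  let y := vsproj Y (daddv_pi Y X h.1) in
  fun y' => psi h.2 * psi ('[vsval y', x] + 2^-1 * '[vsval y, x]) * f (y' + y).

Fact heis_fun_subproof (h : Heis) (f : S) :
  (heis_fun h f : subvs_of Y -> K^o) \in @cc_pred F (subvs_of Y) K.
Proof.
case: h f => w t [f /= /asboolP[fl fc]]; apply/asboolP.
rewrite /heis_fun /=; set x := daddv_pi X Y w; set y := vsproj Y _.
have cy := @vtop_translation _ (subvs_of Y) y.
have cx c : continuous (fun y' : vtop (subvs_of Y) => '[vsval y', x] + c : F).
  apply: continuous_addk; last exact: cst_continuous.
  rewrite (_ : (fun _ => _) = fun y' : vtop (subvs_of Y) =>
    \sum_j coord (vbasis {:subvs_of Y}) j y' * '[vsval (vbasis {:subvs_of Y})`_j, x]).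
    apply: continuous_sumk => j; apply: continuous_mulk; last exact: cst_continuous.
    exact: vtop_coord.
  apply/funext => y'; rewrite {1}(coord_vbasis (memvf y')) linear_sum linear_sumlz /=.
  by apply: eq_bigr => j _; rewrite linearZl_LR.
split.
  move=> y'; near=> z; congr (_ * _ * _); near: z.
    exact: (cx (2^-1 * '[vsval y, x]) y' _ (char_smooth psi _)).
  exact: (cy y' _ (fl _)).
pose D := [set v : vtop (subvs_of Y) |
  closure [set v : vtop (subvs_of Y) | f v != 0] ((v : subvs_of Y) + y)].
have Dclosed : closed D.
  apply: (@preimage_closed _ _
    (fun v : vtop (subvs_of Y) => (v : subvs_of Y) + y : vtop (subvs_of Y))).
    by move=> v _; exact: cy.
  exact: closed_closure.
have Dcompact : compact D.
  rewrite (_ : D = (fun v : vtop (subvs_of Y) => (v : subvs_of Y) - y : vtop (subvs_of Y)) @`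
     closure [set v : vtop (subvs_of Y) | f v != 0]).
    apply: continuous_compact fc; apply: continuous_subspaceT.
    exact: vtop_translation.
  apply/seteqP; split=> [v Dv|_ [v vC <-]]; last by rewrite /D /= subrK.
  by exists ((v : subvs_of Y) + y) => //; rewrite addrK.
apply: (subclosed_compact _ Dcompact); first exact: closed_closure.
rewrite closureE => v; apply; split=> // u /= h; apply: subset_closure => /=.
by apply: contraNneq h => ->; rewrite mulr0.
Unshelve. all: by end_near. Qed.

Definition heis_act (h : Heis) (f : S) : S := MkCc (heis_fun_subproof h f).
End Heisenberg.

Section Metaplectic.
Variables (F : topFieldType) (W : vectType F) (form : {skew_symmetric W}).
Variables (Mp : topGroupType) (p : {multiplicative Mp -> Sp form}) (eps : Mp).

(* The central extension Mp(W) of Sp(W) by {1, -1} is determined up to a unique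
   isomorphism over Sp(W) by being a non-trivial topological double cover; eps is
   its central element -1. A continuous open surjective morphism with discrete
   kernel of order 2 is a covering map of degree 2. *)
Record nontrivial_double_cover : Prop := {
  cover_surj : forall g, exists x, p x = g;
  cover_continuous : continuous p;
  cover_open : forall U, open U -> open (p @` U);
  cover_ker : forall x, p x = 1%g <-> x = 1%g \/ x = eps;
  cover_eps : eps <> 1%g;
  cover_discrete : exists U, [/\ open U, U 1%g & ~ U eps];
  cover_nontrivial : ~ exists s : {multiplicative Sp form -> Mp},
    continuous s /\ cancel s p }.

Variables (X Y : {vspace W}) (lift : Sp form -> Mp).

(* n |-> (n, 1) on N(X). It is the only lift of N(X) which is a morphism, because
   every element of N(X) is a square in N(X). *)
Definition unipotent_lift :=
  [/\ forall n, siegel_unipotent X n -> p (lift n) = n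
    & forall n m, siegel_unipotent X n -> siegel_unipotent X m ->
        lift (n * m)%g = (lift n * lift m)%g].

Variables (K : fieldType) (psi : smooth_char F K).
Variable omega : rep Mp (Cc (subvs_of Y) K).

(* In weil_unipotent, the vector n y - y is by for b = (n - id) restricted to Y. *)
Record weil_rep : Prop := {
  weil_smooth : smooth_rep omega;
  weil_eps : forall f, omega eps f = - f;
  weil_heis : forall x h f,
    omega x (heis_act form psi X h (omega x^-1%g f)) =
      heis_act form psi X (sp_heis (p x) h) f;
  weil_unipotent : forall n (f : Cc (subvs_of Y) K) y, siegel_unipotent X n ->
    omega (lift n) f y =
      psi (2^-1 * form (n (vsval y) - vsval y) (vsval y)) * f y }.
End Metaplectic.

Section Cyclotomic.
Variables (R0 K : fieldType) (iota : {rmorphism R0 -> K}).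

(* K is the union of the R0[zeta_(2^j)] *)
Definition cyclotomic_tower :=
  (forall j, exists z : K, (2 ^ j).-primitive_root z) /\
  (forall x : K, exists j z (q : {poly R0}),
     (2 ^ j).-primitive_root z /\ x = (map_poly iota q).[z]).

Definition galois_aut (s : {rmorphism K -> K}) :=
  bijective s /\ (forall a, s (iota a) = iota a).

(* s acts on 2-power roots of unity by z |-> z^a; when z^(2^(n+1)) = 1, the power
   z^a only involves the component of a in Z/2^(n+1) *)
Definition cyclotomic_char (s : K -> K) (a : Z2) :=
  forall n (z : K), z ^+ (2 ^ n.+1) = 1 -> s z = z ^+ val a n.

(* The squares of units of Z_2 form the group 1 + 8 Z_2. *)
Definition G2' (s : {rmorphism K -> K}) :=
  galois_aut s /\ exists2 u : Z2, u \is a GRing.unit & cyclotomic_char s (u ^+ 2).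

(* the fixed field L of G2' in K *)
Definition fixedL_pred : {pred K} := fun x =>
  `[< forall s : {rmorphism K -> K}, G2' s -> s x = x >].

Lemma fixedL_divring : divring_closed fixedL_pred.
Proof.
split; first by apply/asboolP => s _; rewrite rmorph1.
  by move=> x y /asboolP hx /asboolP hy; apply/asboolP => s hs; rewrite rmorphB hx ?hy.
by move=> x y /asboolP hx /asboolP hy; apply/asboolP => s hs; rewrite fmorph_div hx ?hy.
Qed.
HB.instance Definition _ := GRing.isDivringClosed.Build K fixedL_pred fixedL_divring.

Record fixedL := MkFixedL { fixedL_val :> K ; _ : fixedL_val \in fixedL_pred }.
HB.instance Definition _ := [isSub for fixedL_val].
HB.instance Definition _ := [Choice of fixedL by <:].
HB.instance Definition _ := [SubChoice_isSubIntegralDomain of fixedL by <:].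
HB.instance Definition _ := [SubIntegralDomain_isSubField of fixedL by <:].
End Cyclotomic.

Definition Q_or_Fl (R0 : fieldType) :=
  R0 = rat :> fieldType \/ exists l, [/\ prime l, l <> 2%N & R0 = 'F_l :> fieldType].

Section BaseChange.
Local Open Scope quotient_scope.
Variables (L K : fieldType) (i : {rmorphism L -> K}) (V : lmodType L).

(* V (x)_L K, where L acts on K through i: a sequence s stands for the formal sum of
   the v (x) a for (v, a) in s *)
Inductive tens_rel : seq (V * K) -> seq (V * K) -> Prop :=
| tens_refl s : tens_rel s s
| tens_sym s t : tens_rel s t -> tens_rel t s
| tens_trans s t u : tens_rel s t -> tens_rel t u -> tens_rel s u
| tens_cat s s' t t' : tens_rel s s' -> tens_rel t t' -> tens_rel (s ++ t) (s' ++ t')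
| tens_comm s t : tens_rel (s ++ t) (t ++ s)
| tens_0 a : tens_rel [:: (0, a)] [::]
| tens_addl v w a : tens_rel [:: (v + w, a)] [:: (v, a); (w, a)]
| tens_addr v a b : tens_rel [:: (v, a + b)] [:: (v, a); (v, b)]
| tens_scal c v a : tens_rel [:: (c *: v, a)] [:: (v, i c * a)].

Definition tens_eq : rel (seq (V * K)) := fun s t => `[< tens_rel s t >].
Lemma tens_eq_refl : reflexive tens_eq.
Proof. by move=> s; apply/asboolP/tens_refl. Qed.
Lemma tens_eq_sym : symmetric tens_eq.
Proof. by move=> s t; apply/asboolP/asboolP => /tens_sym. Qed.
Lemma tens_eq_trans : transitive tens_eq.
Proof. by move=> t s u /asboolP st /asboolP tu; apply/asboolP/(tens_trans st). Qed.
Canonical tens_equiv := EquivRel tens_eq tens_eq_refl tens_eq_sym tens_eq_trans.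

Definition tensor : Type := {eq_quot tens_equiv}.
HB.instance Definition _ : EqQuotient _ tens_equiv tensor := EqQuotient.on tensor.
HB.instance Definition _ := Choice.on tensor.

Lemma tensorP s t : \pi_tensor s = \pi_tensor t <-> tens_rel s t.
Proof. by split=> [/eqmodP/asboolP|h]; last exact/eqmodP/asboolP. Qed.

Lemma tens_repr s : tens_rel (repr (\pi_tensor s)) s.
Proof. by apply/tensorP; rewrite reprK. Qed.

Definition tens_map (f : V -> V) (g : K -> K) (s : seq (V * K)) : seq (V * K) :=
  [seq (f va.1, g va.2) | va <- s].

Definition tens_zero : tensor := \pi_tensor [::].
Definition tens_add (x y : tensor) : tensor := \pi_tensor (repr x ++ repr y).
Definition tens_opp (x : tensor) : tensor := \pi_tensor (tens_map -%R id (repr x)).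
Definition tens_scale (a : K) (x : tensor) : tensor := \pi_tensor (tens_map id ( *%R a) (repr x)).

Lemma tens_map_rel (f : {linear V -> V}) a s t :
  tens_rel s t -> tens_rel (tens_map f ( *%R a) s) (tens_map f ( *%R a) t).
Proof.
elim=> {s t} /=.
- by move=> s; apply: tens_refl.
- by move=> s t _; apply: tens_sym.
- by move=> s t u _ st _; apply: tens_trans.
- by move=> s s' t t' _ ss _ tt; rewrite /tens_map !map_cat; apply: tens_cat.
- by move=> s t; rewrite /tens_map !map_cat; apply: tens_comm.
- by move=> b; rewrite /= linear0; apply: tens_0.
- by move=> v w b; rewrite /= linearD; apply: tens_addl.
- by move=> v b c; rewrite /= mulrDr; apply: tens_addr.
- by move=> c v b; rewrite /= linearZ mulrCA; apply: tens_scal.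
Qed.
Lemma tens_addE s t : tens_add (\pi_tensor s) (\pi_tensor t) = \pi_tensor (s ++ t).
Proof. by apply/tensorP/tens_cat; apply: tens_repr. Qed.
Lemma tens_scaleE a s : tens_scale a (\pi_tensor s) = \pi_tensor (tens_map id ( *%R a) s).
Proof. by apply/tensorP/(@tens_map_rel idfun)/tens_repr. Qed.
Lemma tens_oppE s : tens_opp (\pi_tensor s) = \pi_tensor (tens_map -%R id s).
Proof.
have e u : tens_map -%R id u = tens_map -%R ( *%R 1) u.
  by apply: eq_map => -[v a] /=; rewrite mul1r.
by rewrite /tens_opp !e; apply/tensorP/(@tens_map_rel -%R)/tens_repr.
Qed.

Lemma tens_addA : associative tens_add.
Proof. by elim/quotW=> x; elim/quotW=> y; elim/quotW=> z;
  rewrite (tens_addE y z) (tens_addE x y) (tens_addE x) (tens_addE (x ++ y)) catA. Qed.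
Lemma tens_addC : commutative tens_add.
Proof. by elim/quotW=> x; elim/quotW=> y; rewrite (tens_addE x y) (tens_addE y x); apply/tensorP/tens_comm. Qed.
Lemma tens_add0 : left_id tens_zero tens_add.
Proof. by elim/quotW=> x; exact: (tens_addE [::] x). Qed.
Lemma tens_addN : left_inverse tens_zero tens_opp tens_add.
Proof.
elim/quotW=> x; rewrite (tens_oppE x) (tens_addE _ x); apply/tensorP.
elim: x => [|[v a] s IH]; first exact: tens_refl.
have h : tens_rel ([:: (- v, a)] ++ [:: (v, a)]) [::].
  apply: (tens_trans (tens_sym (tens_addl (- v) v a))); rewrite addNr.
  exact: tens_0.
apply: (tens_trans (t := ([:: (- v, a)] ++ [:: (v, a)]) ++ (tens_map -%R id s ++ s))).
  rewrite -!catA; apply: (tens_cat (s := [:: (- v, a)])); first exact: tens_refl.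
  change (tens_rel (tens_map -%R id s ++ ([:: (v, a)] ++ s))
                   ([:: (v, a)] ++ (tens_map -%R id s ++ s))).
  by rewrite !catA; apply: tens_cat; [exact: tens_comm|exact: tens_refl].
exact: (tens_cat h IH).
Qed.
HB.instance Definition _ := GRing.isZmodule.Build tensor
  tens_addA tens_addC tens_add0 tens_addN.

Lemma tens_scaleA a b x : tens_scale a (tens_scale b x) = tens_scale (a * b) x.
Proof.
elim/quotW: x => s; rewrite (tens_scaleE b s) tens_scaleE (tens_scaleE _ s); congr (\pi_tensor _).
by rewrite /tens_map -map_comp; apply: eq_map => -[v c] /=; rewrite mulrA.
Qed.
Lemma tens_scale1 : left_id 1 tens_scale.
Proof.
elim/quotW=> s; rewrite (tens_scaleE 1 s); congr (\pi_tensor _).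
by rewrite /tens_map -[RHS]map_id; apply: eq_map => -[v c] /=; rewrite mul1r.
Qed.
Lemma tens_scaleDr : right_distributive tens_scale +%R.
Proof.
move=> a; elim/quotW=> s; elim/quotW=> t; rewrite [\pi_tensor s + _](tens_addE s t).
rewrite (tens_scaleE a s) (tens_scaleE a t) (tens_scaleE a (s ++ t)) [RHS](tens_addE _ _).
by rewrite /tens_map map_cat.
Qed.
Lemma tens_scaleDl x a b : tens_scale (a + b) x = tens_scale a x + tens_scale b x.
Proof.
elim/quotW: x => s; rewrite !(tens_scaleE _ s) [RHS](tens_addE _ _); apply/tensorP.
elim: s => [|[v c] s IH]; first exact: tens_refl.
apply: (tens_trans (t := [:: (v, a * c); (v, b * c)] ++
    (tens_map id ( *%R a) s ++ tens_map id ( *%R b) s))).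
  by apply: (tens_cat _ IH (s := [:: _])); rewrite /= mulrDl; apply: tens_addr.
apply: (tens_cat (s := [:: _]) (s' := [:: _])); first exact: tens_refl.
change (tens_rel ([:: (v, b * c)] ++ (tens_map id ( *%R a) s ++ tens_map id ( *%R b) s))
  (tens_map id ( *%R a) s ++ ([:: (v, b * c)] ++ tens_map id ( *%R b) s))).
by rewrite !catA; apply: tens_cat; [exact: tens_comm|exact: tens_refl].
Qed.
HB.instance Definition _ := GRing.Zmodule_isLmodule.Build K tensor
  tens_scaleA tens_scale1 tens_scaleDr tens_scaleDl.

Definition tens_lift (f : {linear V -> V}) (x : tensor) : tensor :=
  \pi_tensor (tens_map f id (repr x)).

Lemma tens_liftE (f : {linear V -> V}) s :
  tens_lift f (\pi_tensor s) = \pi_tensor (tens_map f id s).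
Proof.
have e u : tens_map f id u = tens_map f ( *%R 1) u.
  by apply: eq_map => -[v a] /=; rewrite mul1r.
by rewrite /tens_lift !e; apply/tensorP/tens_map_rel/tens_repr.
Qed.

Lemma tens_lift_linear f : linear (tens_lift f).
Proof.
move=> a; elim/quotW=> s; elim/quotW=> t.
rewrite [a *: _](tens_scaleE a s) [X in tens_lift f X](tens_addE _ t) !tens_liftE.
rewrite [a *: _](tens_scaleE a _) [RHS](tens_addE _ _) /tens_map map_cat -!map_comp.
by [].
Qed.
HB.instance Definition _ f := GRing.isLinear.Build K tensor tensor _ (tens_lift f)
  (tens_lift_linear f).

Variables (G : groupType) (r : rep G V).
Definition tens_act (g : G) : {linear tensor -> tensor} := tens_lift (r g).

Lemma tens_rep1 x : tens_act 1%g x = x.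
Proof.
elim/quotW: x => s; rewrite [LHS](tens_liftE _ s); congr (\pi_tensor _).
by rewrite /tens_map -[RHS]map_id; apply: eq_map => -[v a] /=; rewrite rep1.
Qed.

Lemma tens_repM g h x : tens_act (g * h)%g x = tens_act g (tens_act h x).
Proof.
elim/quotW: x => s.
rewrite [LHS](tens_liftE _ s) [tens_act h _](tens_liftE _ s) [RHS](tens_liftE _ _).
congr (\pi_tensor _).
by rewrite /tens_map -map_comp; apply: eq_map => -[v a] /=; rewrite repM.
Qed.

Definition tens_rep : rep G tensor := MkRep tens_rep1 tens_repM.
End BaseChange.

(* Main.v *)
(** An element s of G_{2'} acts on 2-power roots of unity by z |-> z^(u^2) for a
    unique u in 1 + 4 Z_2, and s o psi = psi(u^2 .).  The dilation of the Heisenberg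
    group (w, t) |-> (u w, u^2 t) commutes with Sp(W), so the s-semilinear operator
    (I_s f)(y) = s (f (y / u)) intertwines omega with itself up to a character of
    Sp(W), by Schur's lemma for the Heisenberg representation.  This character is
    trivial on N(X), whose conjugates generate Sp(W): hence the I_s commute with
    omega.  The choice u = 1 mod 4 makes s |-> I_s an action, each f depends on s
    only to finite precision, and Galois descent realises omega on the invariants. *)

Require Import Defs.
From HB Require Import structures.
From mathcomp Require Import all_boot all_order all_algebra all_field sesquilinear.
From mathcomp Require Import all_classical topology.
From mathcomp Require Import ring zify.

Set Implicit Arguments.
Unset Strict Implicit.
Unset Printing Implicit Defensive.

Import GRing.Theory.
Local Open Scope ring_scope.

(** * Generation of the symplectic group *)

Section SymplecticGeneration.
Variables (F : topFieldType) (W : vectType F) (form : {skew_symmetric W}).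
Hypothesis hform : is_psymplectic form.
Local Notation "''[' u , v ]" := (form u%R v%R) : ring_scope.

Lemma skewE u v : '[u, v] = - '[v, u].
Proof. by rewrite hermC expr1 mulN1r. Qed.

(** In characteristic 2 this is part of [is_psymplectic]; otherwise skew symmetry makes twice the
    value vanish. *)
Lemma altE u : '[u, u] = 0.
Proof.
have [_ _ char2] := hform; have [two0|two0] := eqVneq (2%:R : F) 0.
  by apply: char2; rewrite inE two0 eqxx.
apply/eqP; have /eqP := skewE u u; rewrite -addr_eq0 -mulr2n -mulr_natl.
by rewrite mulf_eq0 (negPf two0).
Qed.

Lemma form_nondeg u : u != 0 -> exists v, '[u, v] != 0.
Proof.
move=> u0; have [/eqP nd _ _] := hform.
have /mem_orthovPn[v _ uv] : u \notin orthov form fullv by rewrite nd memv0.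
by exists v.
Qed.

(** A vector space is not the union of two proper subspaces, here the orthogonals of [u] and [v]. *)
Lemma form_nondeg2 u v : u != 0 -> v != 0 ->
  exists z, '[u, z] != 0 /\ '[v, z] != 0.
Proof.
move=> /form_nondeg[a ua] /form_nondeg[b vb].
have [va|va] := eqVneq '[v, a] 0; last by exists a.
have [ub|ub] := eqVneq '[u, b] 0; last by exists b.
by exists (a + b); rewrite !linearDr /= va ub addr0 add0r.
Qed.

Definition transvection_fun (a : F) (v w : W) : W := w + (a * '[w, v]) *: v.

Lemma transvection_fun_linear a v : linear (transvection_fun a v).
Proof.
move=> c x y; rewrite /transvection_fun linearDl linearZl_LR /= mulrDr.
by rewrite scalerDl scalerDr scalerA mulrCA addrACA.
Qed.
HB.instance Definition _ a v :=
  GRing.isLinear.Build F W W _ (transvection_fun a v) (transvection_fun_linear a v).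

Lemma transvection_subproof a v :
  (lker (linfun (transvection_fun a v)) == 0%VS) &&
  `[< isometry form form (linfun (transvection_fun a v)) >].
Proof.
apply/andP; split; last first.
  apply/asboolP => x y; rewrite !lfunE /= /transvection_fun.
  rewrite linearDl !linearDr !linearZl_LR !linearZr_LR /= altE.
  by rewrite (skewE v y); ring.
apply/lker0P => x y; rewrite !lfunE /= /transvection_fun => e.
have e' : '[x, v] = '[y, v].
  have := congr1 (fun z => '[z, v]) e.
  by rewrite !linearDl !linearZl_LR /= altE !mulr0 !addr0.
by move: e; rewrite e' => /addIr.
Qed.
Definition transvection a v : Sp form := MkSp (transvection_subproof a v).

Lemma transvectionE a v w : transvection a v w = w + (a * '[w, v]) *: v.
Proof. by rewrite lfunE. Qed.

Lemma transvectionV a v : (transvection a v)^-1%g = transvection (- a) v.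
Proof.
apply: mulg1_eq; apply/val_inj/lfunP => w.
rewrite comp_lfunE !transvectionE id_lfunE linearDl linearZl_LR /= altE mulr0 addr0.
by rewrite -addrA -scalerDl mulNr addNr scale0r addr0.
Qed.

Lemma transvection_conj (g : Sp form) a v :
  transvection a (g v) = (g * transvection a v * g^-1)%g.
Proof.
have gK u : g ((g^-1)%VF u) = u by rewrite lker0_lfunVK ?sp_ker.
apply/val_inj/lfunP => w; rewrite !comp_lfunE [LHS]transvectionE.
by rewrite [in RHS]transvectionE linearD linearZ /= -[in RHS](sp_isom g) !gK.
Qed.

(** As <v, v> = 0, the pairing <v, v - w> is -<v, w>, so this coefficient subtracts exactly v - w
    from v. *)
Lemma transvection_move v w : '[v, w] != 0 -> transvection ('[v, w]^-1) (v - w) v = w.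
Proof.
move=> vw; rewrite transvectionE linearBr /= altE sub0r mulrN mulVf //.
by rewrite scaleN1r opprB subrKC.
Qed.

Variables (X : {vspace W}) (C : set (Sp form)).
Hypothesis Xlag : lagrangian form X.
Hypothesis W_neq0 : (0 < \dim {:W})%N.
Hypothesis C1 : C 1%g.
Hypothesis CM : forall g h, C g -> C h -> C (g * h)%g.
Hypothesis CJ : forall g h, C h -> C (g * h * g^-1)%g.
Hypothesis CX : forall n, siegel_unipotent X n -> C n.

Lemma lagrangian_nz : exists2 x, x \in X & x != 0.
Proof.
exists (vpick X); first exact: memv_pick.
rewrite vpick0; apply: contraTneq W_neq0 => X0.
by move: Xlag; rewrite /lagrangian X0 orthov0 => /eqP <-; rewrite dimv0.
Qed.

Lemma transvection_siegel a x : x \in X -> C (transvection a x).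
Proof.
move=> xX; apply: CX; split=> [y yX|w]; rewrite transvectionE; last first.
  by rewrite addrC addKr memvZ.
move: yX; rewrite (eqP Xlag) => /mem_orthovP/(_ x xX) ->.
by rewrite mulr0 scale0r addr0.
Qed.

(* Sp(W) is transitive on nonzero vectors, so every transvection is conjugate to
   one along a vector of X. *)
Lemma all_transvections a v : C (transvection a v).
Proof.
have [->|v0] := eqVneq v 0.
  rewrite (_ : transvection a 0 = 1%g) //; apply/val_inj/lfunP => w.
  by rewrite transvectionE scaler0 addr0 id_lfunE.
have move x y : '[x, y] != 0 -> C (transvection a x) -> C (transvection a y).
  by move=> xy Cx; rewrite -(transvection_move xy) transvection_conj; apply: CJ.
have [x xX x0] := lagrangian_nz.
have [z [xz vz]] := form_nondeg2 x0 v0.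
apply: (move z); first by rewrite skewE oppr_eq0.
exact: move xz (transvection_siegel a xX).
Qed.

(** Closure of [C] under products suffices, because the inverse of a transvection is again a
    transvection. *)
Lemma transvection_fix (g : Sp form) a r : C (transvection a r * g)%g -> C g.
Proof.
move=> /(CM (all_transvections (- a) r)).
by rewrite -transvectionV mulKg.
Qed.

(* Multiplying g by one or two transvections enlarges its fixed space: if g w != w,
   then g w is moved to w, directly or through some z in w + im (g - 1); the vectors
   of these transvections lie in im (g - 1), which is orthogonal to the fixed
   space. *)
Lemma normal_siegel_full g : C g.
Proof.
have [n] := ubnP (\dim {:W} - \dim (fixedSpace g)); elim: n g => // n IH g hn.
have [/vspaceP fixg|/eqP nfix] := fixedSpace g =P fullv.
  rewrite (_ : g = 1%g) //; apply/val_inj/lfunP => w; rewrite id_lfunE.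
  by apply/fixedSpaceP; rewrite fixg memvf.
have larger (h : Sp form) w : g w != w -> h w = w ->
    (forall v, g v = v -> h v = v) -> C h.
  move=> gw hw fixh; apply: IH.
  have lt : (\dim (fixedSpace g) < \dim (fixedSpace h))%N.
    rewrite (ltn_leqif (dimv_leqif_sup _)); last first.
      by apply/subvP=> v /fixedSpaceP/fixh/fixedSpaceP.
    by apply: contra gw => /subvP/(_ w) => s; apply/eqP/fixedSpaceP/s/fixedSpaceP.
  have := dimvS (subvf (fixedSpace h)); lia.
have fix_orth v w : g v = v -> '[v, g w - w] = 0.
  by move=> gv; rewrite linearBr /= -{1}gv sp_isom subrr.
have trfix a r v : '[v, r] = 0 -> transvection a r v = v.
  by move=> vr; rewrite transvectionE vr mulr0 scale0r addr0.
have [w gw] : exists w, g w != w.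
  apply/not_existsP => h; case/eqP: nfix; apply/vspaceP => w; rewrite memvf.
  by apply/fixedSpaceP; apply/eqP/negPn/negP/h.
have [gww|gww] := eqVneq '[g w, w] 0; last first.
  apply: (@transvection_fix g ('[g w, w]^-1) (g w - w)).
  apply: (larger _ w gw) => [|v gv]; rewrite comp_lfunE; first exact: transvection_move.
  by rewrite gv trfix // fix_orth.
have wg : w - g w != 0 by rewrite subr_eq0 eq_sym.
have gKg u : (g^-1)%VF (g u) = u by rewrite lker0_lfunK ?sp_ker.
have gK u : g ((g^-1)%VF u) = u by rewrite lker0_lfunVK ?sp_ker.
have wg' : (g^-1)%VF w - w != 0.
  by rewrite subr_eq0; apply: contraNneq gw => e; rewrite -{1}e gK.
(* With <g w, w> = 0, the pairings of z = w + (g v - v) with g w and w are, up to sign, <w - g w, v>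
   and <g^-1 w - w, v>; this [v] makes both nonzero, so g w can be moved to z and then z to w. *)
have [v [v1 v2]] := form_nondeg2 wg wg'.
pose r := g v - v.
have gwr : '[g w, w + r] != 0.
  by rewrite linearDr /= gww add0r linearBr /= sp_isom -linearBl.
have rw : '[w + r, w] != 0.
  rewrite linearDl /= altE add0r skewE oppr_eq0 linearBr /= -{1}(gK w) sp_isom.
  by rewrite -linearBl.
apply: (@transvection_fix g ('[g w, w + r]^-1) (g w - (w + r))).
apply: (@transvection_fix _ ('[w + r, w]^-1) (w + r - w)).
apply: (larger _ w gw) => [|y gy]; rewrite !comp_lfunE.
  by rewrite !transvection_move.
rewrite gy (trfix _ (g w - (w + r))) ?trfix //.
  by rewrite [w + r]addrC addrK fix_orth.
by rewrite opprD addrA linearBr /= !fix_orth // subrr.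
Qed.
End SymplecticGeneration.

(** * Semilinear descent *)

Section Descent.
Local Open Scope quotient_scope.
Variables (L K : fieldType) (i : {rmorphism L -> K}) (M : lmodType K).

(** The indices form a bare type: what descent retains of the Galois group is semilinearity and the
    fact that [i] identifies L with the common fixed field. *)
Record semilinear_family := SemilinearFamily {
  sl_index : Type;
  sl_aut : sl_index -> {rmorphism K -> K};
  sl_act : sl_index -> {additive M -> M};
  sl_actZ : forall g a x, sl_act g (a *: x) = sl_aut g a *: sl_act g x;
  sl_fix : forall g c, sl_aut g (i c) = i c;
  sl_base : forall a, (forall g, sl_aut g a = a) -> exists c, i c = a }.

Variable S : semilinear_family.
Local Notation act := (@sl_act S).
Local Notation aut := (@sl_aut S).

Definition sl_invariant : {pred M} := fun x => `[< forall g, act g x = x >].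

Lemma sl_invariantP x : reflect (forall g, act g x = x) (x \in sl_invariant).
Proof. exact: asboolP. Qed.

Lemma sl_invariant_zmod : zmod_closed sl_invariant.
Proof.
split=> [|x y /sl_invariantP hx /sl_invariantP hy]; apply/sl_invariantP => g.
  by rewrite raddf0.
by rewrite raddfB hx hy.
Qed.
HB.instance Definition _ := GRing.isZmodClosed.Build M sl_invariant sl_invariant_zmod.

Record invariants := Invariants { inv_val :> M; _ : inv_val \in sl_invariant }.
HB.instance Definition _ := [isSub for inv_val].
HB.instance Definition _ := [Choice of invariants by <:].
HB.instance Definition _ := [SubChoice_isSubZmodule of invariants by <:].

Lemma invariants_act g (v : invariants) : act g (val v) = val v :> M.
Proof. by case: v => v /= /sl_invariantP. Qed.

Lemma inv_scale_subproof c (v : invariants) : i c *: val v \in sl_invariant.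
Proof. by apply/sl_invariantP => g; rewrite sl_actZ sl_fix invariants_act. Qed.
Definition inv_scale c v : invariants := Invariants (inv_scale_subproof c v).

Lemma inv_scaleA a b v : inv_scale a (inv_scale b v) = inv_scale (a * b) v.
Proof. by apply/val_inj; rewrite /= scalerA rmorphM. Qed.
Lemma inv_scale1 : left_id 1 inv_scale.
Proof. by move=> v; apply/val_inj; rewrite /= rmorph1 scale1r. Qed.
Lemma inv_scaleDr : right_distributive inv_scale +%R.
Proof. by move=> a u v; apply/val_inj; rewrite /= scalerDr. Qed.
Lemma inv_scaleDl v a b : inv_scale (a + b) v = inv_scale a v + inv_scale b v.
Proof. by apply/val_inj; rewrite /= rmorphD scalerDl. Qed.
HB.instance Definition _ := GRing.Zmodule_isLmodule.Build L invariants
  inv_scaleA inv_scale1 inv_scaleDr inv_scaleDl.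

Notation T := (tensor i invariants).

Definition elem_tensor (v : invariants) (a : K) : T := \pi_T [:: (v, a)].

Lemma pi_tensorE s : \pi_T s = \sum_(va <- s) elem_tensor va.1 va.2.
Proof.
elim: s => [|[v a] s IH]; first by rewrite big_nil.
by rewrite big_cons -IH; symmetry; exact: (tens_addE i [:: (v, a)] s).
Qed.

Lemma elem_tensorZ v a b : a *: elem_tensor v b = elem_tensor v (a * b).
Proof. exact: (tens_scaleE i a [:: (v, b)]). Qed.

Lemma elem_tensorE v a : elem_tensor v a = a *: elem_tensor v 1.
Proof. by rewrite elem_tensorZ mulr1. Qed.

Lemma elem_tensorDl v w a : elem_tensor (v + w) a = elem_tensor v a + elem_tensor w a.
Proof.
rewrite [RHS](tens_addE i [:: (v, a)] [:: (w, a)]).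
exact/tensorP/tens_addl.
Qed.

Lemma elem_tensor0 a : elem_tensor 0 a = 0.
Proof. exact/tensorP/tens_0. Qed.

Lemma elem_tensor_scal c v a : elem_tensor (c *: v) a = elem_tensor v (i c * a).
Proof. exact/tensorP/tens_scal. Qed.

Definition pairing_sum (s : seq (invariants * K)) : M := \sum_(va <- s) va.2 *: val va.1.

Lemma pairing_sum_rel s t : tens_rel i s t -> pairing_sum s = pairing_sum t.
Proof.
rewrite /pairing_sum; elim=> {s t}.
- by [].
- by move=> s t _ ->.
- by move=> s t u _ -> _ ->.
- by move=> s s' t t' _ e _ e'; rewrite !big_cat /= e e'.
- by move=> s t; rewrite !big_cat /= addrC.
- by move=> a; rewrite big_cons !big_nil /= addr0 scaler0.
- by move=> v w a; rewrite !big_cons !big_nil !addr0 /= scalerDr.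
- by move=> v a b; rewrite !big_cons !big_nil !addr0 /= scalerDl.
- by move=> c v a; rewrite !big_cons !big_nil !addr0 /= scalerA mulrC.
Qed.

(** The canonical map v (x) a |-> a v, which Galois descent shows to be bijective. *)
Definition inv_ext (x : T) : M := pairing_sum (repr x).

Lemma inv_extE s : inv_ext (\pi_T s) = pairing_sum s.
Proof. exact/pairing_sum_rel/tens_repr. Qed.

Lemma inv_ext_linear : linear inv_ext.
Proof.
move=> a; elim/quotW=> s; elim/quotW=> t.
rewrite [a *: _](tens_scaleE i a s) [X in inv_ext X](tens_addE i _ t) !inv_extE.
rewrite /pairing_sum big_cat big_map scaler_sumr; congr (_ + _).
by apply: eq_bigr => va _; rewrite scalerA.
Qed.
HB.instance Definition _ := GRing.isLinear.Build K T M _ inv_ext inv_ext_linear.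

Lemma inv_ext_elem v a : inv_ext (elem_tensor v a) = a *: val v.
Proof. by rewrite inv_extE /pairing_sum big_seq1. Qed.

(* Artin's argument: normalise one coefficient to 1; if some automorphism moves
   another coefficient, subtracting the transformed relation gives a shorter one,
   which serves to eliminate a vector. *)
Lemma inv_ext_relation n (v : 'I_n -> invariants) (a : 'I_n -> K) :
  \sum_k a k *: val (v k) = 0 :> M -> \sum_k elem_tensor (v k) (a k) = 0.
Proof.
elim: n v a => [|n IH] v a; first by rewrite !big_ord0.
have IH0 b k0 : b k0 = 0 -> \sum_k b k *: val (v k) = 0 :> M ->
    \sum_k elem_tensor (v k) (b k) = 0.
  move=> b0; rewrite !(bigD1_ord k0) //= b0 scale0r add0r.
  move=> /(IH (fun k => v (lift k0 k))) ->.
  by rewrite elem_tensorE scale0r addr0.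
have [a0|a0] := eqVneq (a ord0) 0; first exact: IH0 a0.
pose b k := (a ord0)^-1 * a k => rel.
have aE k : a k = a ord0 * b k by rewrite mulVKf.
have b0 : b ord0 = 1 by rewrite /b mulVf.
have relb : \sum_k b k *: val (v k) = 0 :> M.
  apply: (scalerI a0); rewrite scaler0 -[RHS]rel scaler_sumr.
  by apply: eq_bigr => k _; rewrite scalerA -aE.
suff relT : \sum_k elem_tensor (v k) (b k) = 0.
  rewrite (eq_bigr (fun k => a ord0 *: elem_tensor (v k) (b k))) => [|k _].
    by rewrite -scaler_sumr relT scaler0.
  by rewrite elem_tensorZ -aE.
(* If all coefficients come from L, they cross the tensor sign and leave one elementary tensor,
   whose vector is the relation itself and hence zero. *)
have [fixb|] := pselect (forall k, exists c, i c = b k).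
  pose c k := projT1 (cid (fixb k)); have cE k : i (c k) = b k by rewrite /c; case: cid.
  rewrite (eq_bigr (fun k => elem_tensor (c k *: v k) 1)) => [|k _]; last first.
    by rewrite elem_tensor_scal mulr1 cE.
  rewrite -(big_morph (elem_tensor^~ 1) (fun x y => elem_tensorDl x y 1) (elem_tensor0 1)).
  rewrite (_ : \sum_k _ = 0) ?elem_tensor0 //; apply/val_inj.
  rewrite raddf_sum /= -[RHS]relb; apply: eq_bigr => k _.
  by rewrite cE.
move=> /existsNP[k0 /(contra_not (@sl_base S (b k0)))/existsNP[g gk0]].
pose d k := aut g (b k) - b k.
have d0 : d ord0 = 0 by rewrite /d b0 rmorph1 subrr.
have dk0 : d k0 != 0 by rewrite subr_eq0; apply/eqP.
have reld : \sum_k d k *: val (v k) = 0 :> M.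
  under eq_bigr do rewrite scalerBl.
  rewrite sumrB relb subr0.
  transitivity (act g (\sum_k b k *: val (v k))); last by rewrite relb raddf0.
  rewrite raddf_sum.
  by apply: eq_bigr => k _; rewrite sl_actZ invariants_act.
(* This [t] kills the coefficient of index [k0] in b - t d. Both b - t d and d, which vanishes at
   [ord0], are then shorter relations, and b is recovered from them. *)
pose t := b k0 / d k0.
have relE (N : lmodType K) (w : 'I_n.+1 -> N) :
    \sum_k (b k - t * d k) *: w k = \sum_k b k *: w k - t *: \sum_k d k *: w k.
  by rewrite scaler_sumr -sumrB; apply: eq_bigr => k _; rewrite scalerBl scalerA.
have e0 : b k0 - t * d k0 = 0 by rewrite divfK ?subrr.
have := IH0 (fun k => b k - t * d k) k0 e0.
rewrite relE relb reld scaler0 subr0 => /(_ erefl).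
have tE c : \sum_k elem_tensor (v k) (c k) = \sum_k c k *: elem_tensor (v k) 1.
  by apply: eq_bigr => k _; apply: elem_tensorE.
by rewrite (tE (fun k => b k - _)) relE -!tE (IH0 _ _ d0 reld) scaler0 subr0.
Qed.

Lemma inv_ext_inj : injective inv_ext.
Proof.
apply: raddf_inj; elim/quotW=> s; rewrite [X in X = _ -> _]inv_extE pi_tensorE /pairing_sum.
rewrite !(big_nth (0, 0)) !big_mkord.
exact: (inv_ext_relation (v := fun k => (nth (0, 0) s k).1)).
Qed.

(* The sums of the z^j f_z are invariant; since the nodes z are distinct, Lagrange
   interpolation recovers f_(z0) from them. *)
Lemma descent_span (Z : seq K) (f : K -> M) (z0 : K) : uniq Z -> z0 \in Z ->
  (forall g z, z \in Z -> aut g z \in Z /\ act g (f z) = f (aut g z)) ->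
  exists x, inv_ext x = f z0.
Proof.
move=> uZ z0Z stab.
have inZ j : \sum_(z <- Z) z ^+ j *: f z \in sl_invariant.
  apply/sl_invariantP => g; rewrite raddf_sum.
  rewrite (eq_big_seq (fun z => aut g z ^+ j *: f (aut g z))) => [|z zZ]; last first.
    by rewrite sl_actZ rmorphXn (stab g z zZ).2.
  rewrite -(big_map (aut g) xpredT (fun z => z ^+ j *: f z)); apply: perm_big.
  (* An injective map of a finite set into itself is a permutation, so reindexing by [aut g]
     preserves the sum. *)
  have uZ' : uniq [seq aut g z | z <- Z] by rewrite map_inj_uniq //; apply: fmorph_inj.
  have sub : {subset [seq aut g z | z <- Z] <= Z}.
    by move=> _ /mapP[z zZ ->]; apply: (stab g z zZ).1.
  by apply: uniq_perm => //; apply: (uniq_min_size uZ' sub _).2; rewrite size_map.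
pose q : {poly K} := \prod_(z <- rem z0 Z) ('X - z%:P).
have qz0 : q.[z0] != 0.
  rewrite -/(root q z0) root_prod_XsubC.
  by rewrite (mem_rem_uniq _ uZ) inE eqxx.
have qz z : z \in Z -> z != z0 -> q.[z] = 0.
  by move=> zZ zz0; apply/eqP; rewrite -/(root q z) root_prod_XsubC mem_rem_uniq // inE zz0.
exists (\sum_(j < size q) elem_tensor (Invariants (inZ j)) ((q.[z0])^-1 * q`_j)).
transitivity (\sum_(j < size q) ((q.[z0])^-1 * q`_j) *: \sum_(z <- Z) z ^+ j *: f z).
  by rewrite raddf_sum; apply: eq_bigr => j _; apply: inv_ext_elem.
under eq_bigr do rewrite -scalerA.
rewrite -scaler_sumr; apply: (scalerI qz0); rewrite scalerA divff // scale1r.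
under eq_bigr do rewrite scaler_sumr.
rewrite exchange_big /= (eq_bigr (fun z => q.[z] *: f z)) => [|z _].
  rewrite (bigD1_seq z0) //= big1_seq ?addr0 // => z /andP[zz0 zZ].
  by rewrite qz // scale0r.
by rewrite horner_coef scaler_suml; apply: eq_bigr => j _; rewrite scalerA.
Qed.

Variables (G : topGroupType) (omega : rep G M).
Hypothesis act_omega : forall g x f, act g (omega x f) = omega x (act g f).

Lemma inv_rep_subproof x (v : invariants) : omega x (val v) \in sl_invariant.
Proof. by apply/sl_invariantP => g; rewrite act_omega invariants_act. Qed.
Definition inv_rep_fun x v : invariants := Invariants (inv_rep_subproof x v).

Lemma inv_rep_linear x : linear (inv_rep_fun x).
Proof. by move=> c u v; apply/val_inj; rewrite /= linearD linearZ. Qed.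
HB.instance Definition _ x :=
  GRing.isLinear.Build L invariants invariants _ (inv_rep_fun x) (inv_rep_linear x).

Lemma inv_rep1 v : inv_rep_fun 1%g v = v.
Proof. by apply/val_inj; rewrite /= rep1. Qed.
Lemma inv_repM x y v : inv_rep_fun (x * y)%g v = inv_rep_fun x (inv_rep_fun y v).
Proof. by apply/val_inj; rewrite /= repM. Qed.
Definition inv_rep : rep G invariants := MkRep inv_rep1 inv_repM.

Lemma inv_rep_smooth : smooth_rep omega -> smooth_rep inv_rep.
Proof.
move=> sm v; rewrite (_ : [set g | _]%classic = [set g | omega g (val v) = val v]%classic).
  exact: sm.
by apply/seteqP; split=> g /= h; [exact: (congr1 inv_val h) | apply/val_inj].
Qed.

Lemma inv_rep_iso : (forall f, exists x, inv_ext x = f) ->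
  rep_iso (tens_rep i inv_rep) omega.
Proof.
move=> sur; exists inv_ext.
  pose h f := projT1 (cid (sur f)); have hK f : inv_ext (h f) = f by rewrite /h; case: cid.
  by exists h => // x; apply: inv_ext_inj; rewrite hK.
move=> x; elim/quotW=> s.
transitivity (pairing_sum (tens_map (inv_rep x) id s)).
  by rewrite [tens_rep _ _ _ _](tens_liftE i _ s); apply: inv_extE.
transitivity (omega x (pairing_sum s)); last by congr (omega x _); rewrite -inv_extE.
rewrite /pairing_sum big_map raddf_sum; apply: eq_bigr => va _.
by rewrite /= linearZ.
Qed.
End Descent.

(** * Compactly supported locally constant functions *)

Section Compactness.
Local Open Scope classical_set_scope.

(** Otherwise the sets C \ Q i generate a proper filter on C, and a cluster point of it contradicts
    the local hypothesis. The index is successively a neighbourhood of 1, a finite list of vectors,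
    and a cyclotomic level. *)
Lemma compact_uniform (T : topologicalType) (I : Type) (join : I -> I -> I) (i0 : I)
    (Q : I -> set T) (C : set T) :
  (forall i j, Q i `<=` Q (join i j)) -> (forall i j, Q j `<=` Q (join i j)) ->
  compact C -> (forall x, C x -> exists i, \forall y \near x, Q i y) ->
  exists i, C `<=` Q i.
Proof.
move=> Ql Qr cC locQ; apply/not_existsP => notQ.
have neC i : C `\` Q i !=set0.
  have /existsNP[x /not_implyP[Cx nQx]] := notQ i.
  by exists x.
have fromF : Filter (filter_from [set: I] (fun i => C `\` Q i)).
  apply: filter_from_filter; first by exists i0.
  move=> i j _ _; exists (join i j) => // x [Cx nQ].
  by split; split=> //; apply: contra_not nQ; [apply: Ql|apply: Qr].
have properF : ProperFilter (filter_from [set: I] (fun i => C `\` Q i)).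
  by apply: filter_from_proper => i _.
have [|x [Cx clx]] := cC _ properF.
  by exists i0 => // x [].
have [i nearx] := locQ x Cx.
have [|y [[_ nQ] Qy]] := clx (C `\` Q i) (Q i) _ nearx; first by exists i.
exact: nQ.
Qed.
End Compactness.

Section SchwartzSpace.
Local Open Scope classical_set_scope.
Variables (k : topFieldType) (V : vectType k) (K : fieldType).
Local Notation S := (Cc V K).

Lemma Cc_ext (f g : S) : f =1 g -> f = g.
Proof. by move=> fg; apply/val_inj/funext. Qed.

Lemma Cc_lc (f : S) : locally_constant (f : vtop V -> K).
Proof. by case: f => f /= /asboolP[]. Qed.

Lemma Cc_support_closed (f : S) : closed [set v : vtop V | f v != 0].
Proof.
rewrite closedE => v; apply: contra_notP => /= /negP/negPn/eqP fv.
apply: filterS (@Cc_lc f v) => w /= fw; apply/negP/negPn.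
by rewrite fw fv.
Qed.

(** Local constancy makes the nonvanishing set closed, so the closure in [cc_pred] adds nothing. *)
Lemma Cc_support (f : S) : compact [set v : vtop V | f v != 0].
Proof.
have /closure_id -> := @Cc_support_closed f.
by case: f => f /= /asboolP[].
Qed.

Lemma Cc_intro (f : V -> K^o) (C : set (vtop V)) :
  locally_constant (f : vtop V -> K) -> compact C -> closed C ->
  (forall v, f v != 0 -> C v) -> f \in @cc_pred k V K.
Proof.
move=> lf cC clC sub; apply/asboolP; split=> //.
apply: (subclosed_compact _ cC); first exact: closed_closure.
by rewrite closureE => v; apply; split.
Qed.

Lemma scale_continuous (s : k) : continuous (fun v : vtop V => s *: (v : V) : vtop V).
Proof. exact: (@linear_continuous k V V ( *:%R s : {linear V -> V})). Qed.

Lemma scale_continuous2 :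
  continuous (fun z : k * vtop V => z.1 *: (z.2 : V) : vtop V).
Proof.
apply: continuous_vtop => i.
rewrite (_ : (fun _ => _) = fun z : k * vtop V => z.1 * coord (vbasis {:V}) i (z.2 : V)).
  apply: continuous_mulk => z; first exact: cvg_fst.
  apply: (@continuous_comp _ (vtop V) k snd (coord (vbasis {:V}) i : vtop V -> k)).
    exact: cvg_snd.
  exact: vtop_coord.
by apply/funext => z; rewrite linearZ.
Qed.

Lemma Cc_mul_subproof (h : V -> K) (f : S) : locally_constant (h : vtop V -> K) ->
  (fun v => h v * f v : K^o) \in @cc_pred k V K.
Proof.
move=> lh; apply: (Cc_intro _ (@Cc_support f) (@Cc_support_closed f)) => [v|v /=].
  by near=> w; congr (_ * _); near: w; [apply: lh|apply: Cc_lc].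
by apply: contraNneq => ->; rewrite mulr0.
Unshelve. all: by end_near. Qed.

Lemma Cc_twist_subproof (s : K -> K) (u : k) (f : S) : s 0 = 0 -> u != 0 ->
  (fun v => s (f (u *: v)) : K^o) \in @cc_pred k V K.
Proof.
move=> s0 u0.
(* The new support lies in [D], which is compact as an image under u^-1 and closed as a preimage
   under u. *)
pose D := (fun v : vtop V => u^-1 *: (v : V) : vtop V) @` [set v : vtop V | f v != 0].
have DE : D = (fun v : vtop V => u *: (v : V) : vtop V) @^-1` [set v : vtop V | f v != 0].
  apply/seteqP; split=> [_ [v fv <-]|v fv]; first by rewrite /= scalerA divff ?scale1r.
  by exists (u *: (v : V)) => //; rewrite scalerA mulVf ?scale1r.
apply: (Cc_intro (C := D)) => [v||| v /= fv].
- have := @scale_continuous u v _ (@Cc_lc f (u *: (v : V))).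
  by move=> h; near=> w; congr s; near: w.
- apply: (continuous_compact _ (@Cc_support f)).
  exact: continuous_subspaceT (@scale_continuous u^-1).
- rewrite DE; apply: preimage_closed (@Cc_support_closed f) => v _.
  exact: scale_continuous.
- by rewrite DE /=; apply: contraNneq fv => ->; rewrite s0.
Unshelve. all: by end_near. Qed.

(** Joint continuity of scaling at (1, v) gives this near each v; compactness of the support gives
    one neighbourhood of 1 for all v. *)
Lemma Cc_dilation (f : S) : \forall s \near (1 : k), forall v,
  f v != 0 -> f (s *: v) = f v.
Proof.
pose I := {A : set k | nbhs (1 : k) A}.
pose I0 : I := exist _ setT (@filterT _ _ (@nbhs_filter k 1)).
pose join (A B : I) : I := exist _ (sval A `&` sval B)
  (@filterI _ _ (@nbhs_filter k 1) _ _ (svalP A) (svalP B)).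
pose Q (A : I) : set (vtop V) := [set v | forall s, sval A s -> f (s *: (v : V)) = f v].
have [||v _|[A nA] QA] := compact_uniform (join := join) I0 (Q := Q) _ _ (@Cc_support f).
- by move=> A B v Qv s [/Qv].
- by move=> A B v Qv s [_ /Qv].
- have := @Cc_lc f v; rewrite -{1}[v : V]scale1r => /(@scale_continuous2 (1, v)).
  case=> -[/= P P'] [/= nP nP'] PQ; exists (exist _ P nP).
  have P1 : P 1 by apply: nbhs_singleton.
  apply: filterS nP' => w P'w s Ps /=.
  rewrite (PQ (s, w) (conj Ps P'w)); symmetry.
  by have := PQ (1, w) (conj P1 P'w); rewrite /= scale1r.
- by apply: (filterS _ nA) => s As v fv; apply: QA.
Qed.
End SchwartzSpace.

(** * Schur's lemma for the Heisenberg representation *)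

Section HeisenbergSchur.
Local Open Scope classical_set_scope.
Variables (k : topFieldType) (W : vectType k) (form : {skew_symmetric W}).
Variables (X Y : {vspace W}) (K : fieldType) (psi : smooth_char k K).
Hypothesis hform : is_psymplectic form.
Hypothesis hXY : polarisation form X Y.
Hypothesis psi_nontrivial : exists x, psi x != 1.
Local Notation "''[' u , v ]" := (form u%R v%R) : ring_scope.
Local Notation S := (Cc (subvs_of Y) K).
Local Notation rho := (heis_act form psi X).

Lemma char0 : psi 0 = 1.
Proof.
apply: (mulfI (char_neq0 psi 0)); rewrite -charD addr0 mulr1 //.
Qed.

Lemma heis_actX x (f : S) y : x \in X -> rho (x, 0) f y = psi '[vsval y, x] * f y.
Proof.
move=> xX; have [_ _ XY0 _] := hXY; rewrite /= /heis_fun /=.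
have -> : daddv_pi Y X x = 0.
  have /eqP := daddv_pi_add XY0 (subvP (addvSl X Y) x xX).
  by rewrite (daddv_pi_id XY0 xX) addrC eq_sym -subr_eq subrr => /eqP <-.
by rewrite (daddv_pi_id XY0 xX) !linear0 linear0l mulr0 !addr0 char0 mul1r.
Qed.

Lemma heis_actY (z y : subvs_of Y) (f : S) : rho (vsval z, 0) f y = f (y + z).
Proof.
have [_ _ XY0 _] := hXY; have YX0 : (Y :&: X = 0)%VS by rewrite capvC.
rewrite /= /heis_fun /=.
have -> : daddv_pi X Y (vsval z) = 0.
  have /eqP := daddv_pi_add YX0 (subvP (addvSl Y X) _ (subvsP z)).
  by rewrite (daddv_pi_id YX0 (subvsP z)) addrC eq_sym -subr_eq subrr => /eqP <-.
by rewrite (daddv_pi_id YX0 (subvsP z)) vsvalK !linear0r mulr0 addr0 char0 !mul1r.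
Qed.

Lemma pairing_continuous x :
  continuous (fun y : vtop (subvs_of Y) => '[vsval y, x] : k).
Proof.
rewrite (_ : (fun y => _) = fun y : vtop (subvs_of Y) =>
  \sum_j coord (vbasis {:subvs_of Y}) j y * '[vsval (vbasis {:subvs_of Y})`_j, x]).
  apply: continuous_sumk => j; apply: continuous_mulk; last exact: cst_continuous.
  exact: vtop_coord.
apply/funext => y; rewrite {1}(coord_vbasis (memvf y)) linear_sum linear_sumlz /=.
by apply: eq_bigr => j _; rewrite linearZl_LR.
Qed.

Lemma char_pairing_lc x :
  locally_constant (fun y : vtop (subvs_of Y) => psi '[vsval y, x]).
Proof. by move=> y; apply: pairing_continuous (char_smooth psi _). Qed.

(** As Y is its own orthogonal, a vector pairing nontrivially with [y] may be taken in X; rescaling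
    it makes the pairing any prescribed [a] with psi a != 1. *)
Lemma char_separates (y : subvs_of Y) : y != 0 ->
  exists2 x, x \in X & psi '[vsval y, x] != 1.
Proof.
move=> y0; have [a psia] := psi_nontrivial.
have y0' : vsval y != 0.
  by apply: contraNneq y0 => e; apply/eqP/subvs_inj; rewrite e linear0.
have [w yw] := form_nondeg hform y0'.
have [_ Ylag XY0 XYf] := hXY.
have wE : '[vsval y, daddv_pi X Y w] = '[vsval y, w].
  rewrite -{2}(daddv_pi_add XY0 (_ : w \in X + Y)%VS) ?XYf ?memvf // linearDr /=.
  have YY : (Y <= orthov form Y)%VS by rewrite -(eqP Ylag).
  have /mem_orthovP/(_ _ (memv_pi Y X w)) -> := subvP YY _ (subvsP y).
  by rewrite addr0.
exists ((a / '[vsval y, w]) *: daddv_pi X Y w); first by rewrite memvZ ?memv_pi.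
by rewrite linearZr_LR /= wE divfK.
Qed.

Variables (s : {rmorphism K -> K}) (u : k) (B : {additive S -> S}).
Hypothesis u_neq0 : u != 0.
Hypothesis BZ : forall a f, B (a *: f) = s a *: B f.
Hypothesis B_heis : forall w f, B (rho (w, 0) f) = rho (u *: w, 0) (B f).

(** Elements of X act at the point 0 through psi 0 = 1, and dilation by [u] preserves X. *)
Lemma value0_char x f : x \in X -> B (rho (x, 0) f) 0 = B f 0.
Proof.
by move=> xX; rewrite B_heis heis_actX ?memvZ // linear0 linear0l char0 mul1r.
Qed.

(* A function supported where one of finitely many characters psi<., x> is
   nontrivial is a sum of functions of the form rho(x, 0) g - g. *)
Lemma value0_cover (xs : seq W) (f : S) : {subset xs <= X} ->
  (forall y, f y != 0 -> exists2 x, x \in xs & psi '[vsval y, x] != 1) ->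
  B f 0 = 0.
Proof.
elim: xs f => [|x xs IH] f sub cov.
  rewrite (_ : f = 0) ?raddf0 //; apply/Cc_ext => y; apply/eqP/negPn/negP.
  by move=> /cov[x].
have xX : x \in X by apply: sub; rewrite mem_head.
(* Where psi<y, x> != 1, this gives (psi<y, x> - 1) g y = f y. Hence [f'] below is f cut off to the
   locus psi<y, x> = 1, where [xs] alone covers the support. *)
pose h (y : subvs_of Y) : K := (psi '[vsval y, x] - 1)^-1.
have lh : locally_constant (h : vtop (subvs_of Y) -> K).
  by move=> y; apply: filterS (char_pairing_lc x y) => z e; rewrite /h e.
pose g : S := MkCc (Cc_mul_subproof f lh).
pose f' := f - (rho (x, 0) g - g).
have f'E y : f' y = if psi '[vsval y, x] == 1 then f y else 0.
  have -> : f' y = f y - (rho (x, 0) g y - g y) by [].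
  rewrite heis_actX // -{2}[g y]mul1r -mulrBl /= /h.
  have [->|ne1] := eqVneq; first by rewrite subrr mul0r subr0.
  by rewrite mulVKf ?subrr // subr_eq0.
have -> : f = f' + (rho (x, 0) g - g) by rewrite subrK.
have -> : B (f' + (rho (x, 0) g - g)) 0 = B f' 0 + (B (rho (x, 0) g) 0 - B g 0).
  by rewrite (raddfD B f') (raddfB B (rho (x, 0) g)).
rewrite value0_char // subrr addr0; apply: IH => [z zxs|y].
  by apply: sub; rewrite inE zxs orbT.
rewrite f'E; case: ifP => [/eqP e /cov[z]|_ /eqP//].
by rewrite inE => /orP[/eqP ->|zxs ne]; [rewrite e eqxx | exists z].
Qed.

(** The support avoids 0, so near each of its points some character of X stays nontrivial; by
    compactness finitely many characters suffice. *)
Lemma value0_eq0 (f : S) : f 0 = 0 -> B f 0 = 0.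
Proof.
move=> f0.
pose inX (xs : seq W) := all (mem X) xs; pose I := {xs : seq W | inX xs}.
have allcat (xs ys : I) : inX (val xs ++ val ys).
  by rewrite /inX all_cat; apply/andP; split; [exact: valP xs|exact: valP ys]. 
pose join (xs ys : I) : I := exist inX _ (allcat xs ys).
pose I0 : I := exist inX [::] isT.
pose Q (xs : I) : set (vtop (subvs_of Y)) :=
  [set y | exists2 x, x \in val xs & psi '[vsval y, x] != 1].
have [||y fy|xs cov] := compact_uniform (join := join) I0
  (Q := Q) _ _ (@Cc_support _ _ _ f).
- by move=> i j y [x xi ne]; exists x => //=; rewrite mem_cat xi.
- by move=> i j y [x xi ne]; exists x => //=; rewrite mem_cat xi orbT.
- have /char_separates[x xX ne] : (y : subvs_of Y) != 0.
    by apply: contraNneq fy => ->; rewrite f0.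
  have xX' : inX [:: x] by rewrite /inX /= xX.
  exists (exist inX [:: x] xX'); apply: filterS (char_pairing_lc x y) => z e.
  by exists x; rewrite ?inE //= e.
apply: (value0_cover (xs := val xs)) => [x|y /cov //].
exact: (allP (valP xs)).
Qed.

(** Translations by Y reduce to the point 0, where B f depends only on f 0 by [value0_eq0]; one f0
    with f0 0 != 0 determines the constant. *)
Lemma heis_schur : exists c, forall f y, B f y = c * s (f (u^-1 *: y)).
Proof.
have trans f y : B f y = B (rho (vsval (u^-1 *: y), 0) f) 0.
  rewrite B_heis (_ : u *: vsval (u^-1 *: y) = vsval y) ?heis_actY ?add0r //.
  have -> : vsval (u^-1 *: y) = u^-1 *: vsval y by [].
  by rewrite scalerA divff ?scale1r.
have [[f0 f00]|allz] := pselect (exists f : S, f 0 != 0).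
  exists ((s (f0 0))^-1 * B f0 0) => f y; rewrite trans.
  set h := rho _ f; have hE : h 0 = f (u^-1 *: y) by rewrite /h heis_actY add0r.
  pose a : K := h 0 / f0 0.
  have : B (h - a *: f0) 0 = 0.
    by apply: value0_eq0; rewrite [LHS](_ : _ = h 0 - a * f0 0) // divfK ?subrr.
  rewrite raddfB BZ => /eqP; rewrite [X in X == 0](_ : _ = B h 0 - s a * B f0 0) //.
  by rewrite subr_eq0 => /eqP ->; rewrite /a hE fmorph_div -mulrA mulrC.
(* If every function vanishes at 0, translations make the whole space zero and any constant
   serves. *)
exists 1 => f y.
have z0 (g : S) z : g z = 0.
  rewrite -[z]add0r -heis_actY; apply/eqP/negPn/negP => ne; apply: allz.
  by exists (rho (vsval z, 0) g).
by rewrite !z0 rmorph0 mulr0.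
Qed.
End HeisenbergSchur.

(** * Square roots in 1 + 4 Z_2 *)

Section DyadicIntegers.

Lemma z2_natr (m n : nat) : val (m%:R : Z2) n = m%:R.
Proof. by elim: m => [|m IH] //; rewrite -natr1 -[RHS]natr1 -IH. Qed.

Lemma z2_divide (x : Z2) n : val x n = 0 -> exists y, x = 2 ^+ n.+1 * y.
Proof.
(* Division by 2^(n+1) costs n + 1 binary digits, hence the shift of the index. *)
move=> x0; pose q m := (val x (m + n.+1) %/ 2 ^ n.+1)%N.
have qE m : (val x (m + n.+1) : nat) = (q m * 2 ^ n.+1)%N.
  rewrite divnK // /dvdn -z2_mod ?x0 // addnS leqW ?leq_addl //.
have q_red m : ((q m.+1)%:R : 'Z_(2 ^ m.+1)) = (q m)%:R.
  rewrite -(Z2_red_nat (q m.+1) (leqnn m)); congr (_%:R).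
  apply/eqP; rewrite -(eqn_pmul2r (_ : 0 < 2 ^ n.+1)%N) ?expn_gt0 // muln_modl.
  by rewrite -expnD addSn -!qE -z2_mod // leq_add2r.
pose y : Z2prod := fun m => (q m)%:R.
have yP : y \in z2_compat.
  by apply/asboolP => m; rewrite /y val_Zp_nat ?pow2_gt1 // Z2_red_nat // q_red.
exists (MkZ2 yP); apply/val_inj/z2p_ext => m.
have -> : val (2 ^+ n.+1 * MkZ2 yP) m = val (2 ^+ n.+1 : Z2) m * y m by [].
by rewrite -natrX z2_natr (z2_red x (leq_addr n.+1 m)) qE natrM mulrC.
Qed.

Lemma z2_approx (x : Z2) n : exists y, x = (val x n : nat)%:R + 2 ^+ n.+1 * y.
Proof.
have [|y e] := @z2_divide (x - (val x n : nat)%:R) n; last by exists y; rewrite -e subrKC.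
have -> : val (x - (val x n : nat)%:R) n = val x n - val ((val x n : nat)%:R : Z2) n by [].
by rewrite z2_natr natr_Zp subrr.
Qed.

(** Some multiple z w is a power 2^j; since z is odd, w is even while j > 0, and factors 2 cancel
    down to j = 0. *)
Lemma z2_odd_unit (z : Z2) : val z 0%N = 1 -> z \is a GRing.unit.
Proof.
move=> z1; have z0 : z != 0 by apply/eqP => e; move: z1; rewrite e => /eqP.
have [j [w zw]] := z2_pow2_multiple z0.
elim: j w zw => [|j IH] w zw.
  by apply/unitrP; exists w; rewrite mulrC zw.
have w0 : val w 0%N = 0.
  have := congr1 (fun x : Z2 => val x 0%N) zw; rewrite z2_valM z1 mul1r => ->.
  by rewrite exprS z2_valM (z2_natr 2 0) [X in X * _](_ : _ = 0) ?mul0r //; apply: val_inj.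
have [w' w'E] := z2_divide w0; apply: (IH w').
have two0 : (2 : Z2) != 0.
  apply/eqP => /(congr1 (fun x : Z2 => val x 1%N)); rewrite z2_natr => /(congr1 val).
  by [].
apply: (mulfI two0); rewrite -exprS -zw w'E expr1; ring.
Qed.

(** The component of index 1 lies in Z/4, whose only units are 1 and -1. *)
Lemma z2_unit_mod4 (u : Z2) : u \is a GRing.unit -> val u 1%N = 1 \/ val (- u) 1%N = 1.
Proof.
move=> /unitrP[y [yu _]]; have := congr1 (fun x : Z2 => val x 1%N) yu.
rewrite z2_valM [val (- u) _](_ : _ = - val u 1%N) //.
rewrite [RHS](_ : _ = 1) //; move: (val y 1%N) (val u 1%N).
case=> [[|[|[|[|a]]]] ha] //; case=> [[|[|[|[|b]]]] hb] // /eqP //= _;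
  by [left; apply: val_inj|right; apply: val_inj].
Qed.

Lemma z2_mod4 (u : Z2) : val u 1%N = 1 -> exists t, u = 1 + 4 * t.
Proof.
move=> u1; have [t tE] := z2_approx u 1%N; exists t.
by rewrite tE u1 -natrX.
Qed.

Lemma z2_mod4_unit (u : Z2) : val u 1%N = 1 -> u \is a GRing.unit.
Proof. by move=> u1; apply: z2_odd_unit; rewrite (z2_red u (leq0n 1)) u1. Qed.

(* Squaring is injective on 1 + 4 Z_2 and loses one digit of precision. *)
Lemma z2_sqr_inj (u v : Z2) n : val u 1%N = 1 -> val v 1%N = 1 ->
  val (u ^+ 2) n.+1 = val (v ^+ 2) n.+1 -> exists t, u = v * (1 + 2 ^+ n.+1 * t).
Proof.
move=> u1 v1 uv; have vU := z2_mod4_unit v1.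
have [a aE] := z2_mod4 u1; have [b bE] := z2_mod4 v1.
have [|c cE] := @z2_divide (u ^+ 2 - v ^+ 2) n.+1.
  by rewrite [LHS](_ : _ = val (u ^+ 2) n.+1 - val (v ^+ 2) n.+1) // uv subrr.
(* Here u + v = 2 w with w odd, so dividing u^2 - v^2 by u + v loses exactly one factor 2. *)
pose w : Z2 := 1 + 2 * (a + b).
have wU : w \is a GRing.unit.
  apply: z2_odd_unit; rewrite [LHS](_ : _ = 1 + val (2%:R : Z2) 0%N * val (a + b) 0%N) //.
  by rewrite z2_natr (_ : 2%:R = 0) ?mul0r ?addr0 //; apply: val_inj.
have two0 : (2 : Z2) != 0.
  by apply/eqP => /(congr1 (fun x : Z2 => val x 1%N)); rewrite z2_natr => /(congr1 val).
have uvE : (u - v) * w = 2 ^+ n.+1 * c.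
  apply: (mulfI two0); rewrite [RHS]mulrA -exprS -cE subr_sqr.
  by rewrite (_ : u + v = 2 * w); [ring|rewrite aE bE /w; ring].
exists (c / w / v); apply: (mulIr wU); apply/eqP; rewrite -subr_eq0.
have -> : v * (1 + 2 ^+ n.+1 * (c / w / v)) * w = v * w + 2 ^+ n.+1 * c * (v / v) * (w / w).
  by ring.
by rewrite !divrr // !mulr1 -uvE mulrBl subrKC subrr.
Qed.
End DyadicIntegers.

(** * Small dilations in a 2-adic field *)

Section Adic.
Local Open Scope classical_set_scope.
Variable F : fieldExtType Q2.

Definition adic_emb : Z2 -> adic F := in_alg F \o (@tofrac Z2).
HB.instance Definition _ := GRing.RMorphism.copy adic_emb (in_alg F \o (@tofrac Z2)).

Lemma adic_emb_near (A : set (adic F)) : nbhs (0 : adic F) A ->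
  exists n, forall z, A (adic_emb (2 ^+ n * z)).
Proof.
have cont : continuous (fun t : Q2 => t *: (1 : F) : vtop F).
  apply: continuous_vtop => i.
  rewrite (_ : (fun _ => _) = fun t => t * coord (vbasis {:F}) i 1).
    apply: continuous_mulk; last exact: cst_continuous.
    by move=> t; apply: cvg_id.
  by apply/funext => t; rewrite linearZ.
move=> nA0; have /(cont 0)/Q2_nbhsP[n nA] : nbhs ((0 : Q2) *: (1 : F) : vtop F) A.
  by rewrite scale0r.
exists n => z; have := nA z; rewrite /= add0r /adic_emb /= rmorphM rmorphXn rmorph_nat.
by [].
Qed.

Lemma near_dilation (x : adic F) (A : set (adic F)) : nbhs x A ->
  exists n, forall z, A (adic_emb (1 + 2 ^+ n * z) * x).
Proof.
move=> nA; have : nbhs (0 : adic F) [set t | A ((1 + t) * x)].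
  have := @continuous_mulk (adic F) (adic F) (fun t => 1 + t) (fun=> x).
  move=> /(_ _ (@cst_continuous _ _ x)) h; apply: h; last by rewrite addr0 mul1r.
  apply: continuous_addk; first exact: cst_continuous.
  by move=> t; apply: cvg_id.
by move=> /adic_emb_near[n An]; exists n => z; rewrite rmorphD rmorph1; apply: An.
Qed.
End Adic.
(** * The twisted Galois action *)

Section GaloisTwist.
Local Open Scope classical_set_scope.
Variables (R0 K : fieldType) (iota : {rmorphism R0 -> K}) (F : fieldExtType Q2).
Variable psi : smooth_char (adic F) K.
Local Notation emb := (@adic_emb F).

Lemma char_natr m x : psi (m%:R * x) = psi x ^+ m.
Proof.
elim: m => [|m IH]; first by rewrite mul0r char0.
by rewrite -natr1 mulrDl mul1r charD IH exprSr.
Qed.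

(** Smoothness makes psi trivial on 2^n Z_2 x for some n, so psi x is a 2-power root of unity and
    only a finite-level component of [a] matters. *)
Lemma char_galois (s : K -> K) (a : Z2) x :
  cyclotomic_char s a -> s (psi x) = psi (emb a * x).
Proof.
move=> sa; have [n nP] := near_dilation (char_smooth psi x).
have triv z : psi (emb (2 ^+ n * z) * x) = 1.
  apply: (mulfI (char_neq0 psi x)); rewrite -charD mulr1 -[RHS](nP z).
  by rewrite rmorphD rmorph1 mulrDl mul1r.
(* The exponent n + 1 is that of Z/2^(n+1), where the component of [a] of index n lives; hence
   [triv] is used at 2. *)
have tors : psi x ^+ (2 ^ n.+1) = 1.
  by rewrite -char_natr -[RHS](triv 2) -exprSr -natrX rmorph_nat.
rewrite (sa n _ tors) -char_natr; have [y {2}->] := z2_approx a n.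
by rewrite rmorphD rmorph_nat mulrDl charD exprSr -mulrA triv mulr1.
Qed.

(* An element of G_{2'} has two square roots u and -u; taking u in 1 + 4 Z_2 makes
   the root multiplicative, so that the twists below form an action. *)
Record gal2 := Gal2 {
  gal2_aut : {rmorphism K -> K};
  gal2_root : Z2;
  gal2_galois : galois_aut iota gal2_aut;
  gal2_mod4 : val gal2_root 1%N = 1;
  gal2_char : cyclotomic_char gal2_aut (gal2_root ^+ 2) }.

Lemma gal2_G2' g : G2' iota (gal2_aut g).
Proof.
split; first exact: gal2_galois.
by exists (gal2_root g); [apply/z2_mod4_unit/gal2_mod4 | apply: gal2_char].
Qed.

Lemma G2'_gal2 s : G2' iota s -> exists g, gal2_aut g = s.
Proof.
move=> [sgal [u uU su]]; have [u1|u1] := z2_unit_mod4 uU.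
  by exists (Gal2 sgal u1 su).
by rewrite -sqrrN in su; exists (Gal2 sgal u1 su).
Qed.

Lemma gal2_id_subproof : cyclotomic_char (idfun : K -> K) (1 ^+ 2).
Proof. by move=> n z _; rewrite expr1n. Qed.
Lemma galois_aut_id : galois_aut iota idfun.
Proof. by split=> //; exists idfun. Qed.
Definition gal2_id : gal2 :=
  @Gal2 idfun 1 galois_aut_id erefl gal2_id_subproof.

Lemma cyclotomic_charM (s t : {rmorphism K -> K}) a b :
  cyclotomic_char s a -> cyclotomic_char t b -> cyclotomic_char (s \o t) (a * b).
Proof.
move=> sa tb n z zn; rewrite /= (tb n z zn) rmorphXn (sa n z zn) -exprM.
by rewrite [X in _ = z ^+ X](val_ZpM (val a n) (val b n)) expr_mod // mulnC.
Qed.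

Lemma galois_autM (s t : {rmorphism K -> K}) :
  galois_aut iota s -> galois_aut iota t -> galois_aut iota (s \o t).
Proof.
move=> [bs si] [bt ti]; split; first exact: bij_comp.
by move=> a; rewrite /= ti si.
Qed.

Lemma gal2_mul_mod4 g h : val (gal2_root g * gal2_root h) 1%N = 1.
Proof. by rewrite z2_valM !gal2_mod4 mulr1. Qed.
Lemma gal2_mul_char g h :
  cyclotomic_char (gal2_aut g \o gal2_aut h) ((gal2_root g * gal2_root h) ^+ 2).
Proof. by rewrite exprMn; apply: cyclotomic_charM; apply: gal2_char. Qed.
Definition gal2_mul g h : gal2 :=
  Gal2 (galois_autM (gal2_galois g) (gal2_galois h)) (gal2_mul_mod4 g h)
    (gal2_mul_char g h).

Lemma gal2_emb_neq0 g : emb (gal2_root g) != 0.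
Proof. by rewrite -unitfE rmorph_unit // z2_mod4_unit ?gal2_mod4. Qed.

Section Twist.
Variable V : vectType (adic F).
Local Notation S := (Cc V K).

Definition twist_fun g (f : S) : S :=
  MkCc (Cc_twist_subproof f (rmorph0 (gal2_aut g)) (invr_neq0 (gal2_emb_neq0 g))).

Lemma twistE g f v : twist_fun g f v = gal2_aut g (f ((emb (gal2_root g))^-1 *: v)).
Proof. by []. Qed.

Lemma twist_additive g : additive (twist_fun g).
Proof. by move=> f f'; apply/Cc_ext => v; apply: (rmorphB (gal2_aut g)). Qed.
HB.instance Definition _ g :=
  GRing.isZmodMorphism.Build S S (twist_fun g) (twist_additive g).

Lemma twistZ g a (f : S) : twist_fun g (a *: f) = gal2_aut g a *: twist_fun g f.
Proof. by apply/Cc_ext => v; apply: (rmorphM (gal2_aut g)). Qed.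

Lemma twist_id f : twist_fun gal2_id f = f.
Proof. by apply/Cc_ext => v; rewrite twistE /= rmorph1 invr1 scale1r. Qed.

Lemma twistM g h f : twist_fun (gal2_mul g h) f = twist_fun g (twist_fun h f).
Proof.
by apply/Cc_ext => v; rewrite !twistE /= scalerA rmorphM invfM mulrC.
Qed.

Lemma twist_fix g (c : fixedL iota) : gal2_aut g (val c) = val c.
Proof. by case: c => c /= /asboolP; apply; apply: gal2_G2'. Qed.

Lemma twist_base a : (forall g, gal2_aut g a = a) -> exists c : fixedL iota, val c = a.
Proof.
move=> fixa; have aL : a \in fixedL_pred iota.
  by apply/asboolP => s /G2'_gal2[g <-].
by exists (MkFixedL aL).
Qed.

Definition twist_family : semilinear_family (val : {rmorphism fixedL iota -> K}) S :=
  @SemilinearFamily _ _ _ _ gal2 gal2_aut (fun g => twist_fun g)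
    twistZ twist_fix twist_base.
End Twist.
End GaloisTwist.

(** * Finite level of the twists and descent of Schwartz functions *)

Section TwistSpan.
Local Open Scope classical_set_scope.
Variables (R0 K : fieldType) (iota : {rmorphism R0 -> K}) (F : fieldExtType Q2).
Hypothesis hK : cyclotomic_tower iota.
Variable V : vectType (adic F).
Local Notation S := (Cc V K).
Local Notation emb := (@adic_emb F).
Local Notation gal2 := (gal2 iota).

(** Each value has some cyclotomic level and f is locally constant, so compactness of the support
    bounds the level. *)
Lemma Cc_values (f : S) : exists N, forall v, f v != 0 ->
  exists j z (q : {poly R0}),
    [/\ (j <= N)%N, (2 ^ j).-primitive_root z & f v = (map_poly iota q).[z]].
Proof.
pose Q N : set (vtop V) := [set v | exists j z (q : {poly R0}),
  [/\ (j <= N)%N, (2 ^ j).-primitive_root z & f v = (map_poly iota q).[z]]].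
have [||v _|N sub] := compact_uniform (join := maxn) 0%N (Q := Q) _ _ (@Cc_support _ _ _ f).
- move=> N N' v [j [z [q [jN zj fv]]]]; exists j, z, q; split=> //.
  by rewrite leq_max jN.
- move=> N N' v [j [z [q [jN zj fv]]]]; exists j, z, q; split=> //.
  by rewrite leq_max jN orbT.
- have [j [z [q [zj fv]]]] := hK.2 (f v); exists j.
  by apply: filterS (@Cc_lc _ _ _ f v) => w fw; exists j, z, q; rewrite fw.
- by exists N.
Qed.

Lemma Cc_dilation_adic (f : S) : exists n, forall z v,
  f v != 0 -> f (emb (1 + 2 ^+ n * z) *: v) = f v.
Proof.
have [n An] := near_dilation (Cc_dilation f).
by exists n => z v fv; have := An z v fv; rewrite mulr1.
Qed.

(* The twist of f by g only depends on g up to a finite precision: f has finitely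
   many values, and is invariant under dilations close to 1. *)
Lemma twist_finite_level (f : S) : exists m, forall (g h : gal2) (zeta : K),
  (2 ^ m.+2).-primitive_root zeta -> gal2_aut g zeta = gal2_aut h zeta ->
  twist_fun g f = twist_fun h f.
Proof.
have [N valN] := Cc_values f; have [n dil] := Cc_dilation_adic f.
(* The action on [zeta] fixes the squared root modulo 2^(m+2), hence the root up to 1 + 2^(m+1) Z_2.
   This is precise enough for the values, as N <= m + 2, and for the dilations, as n <= m + 1. *)
pose m := (N + n)%N; exists m => g h zeta zprim gh.
have chareq : val (gal2_root g ^+ 2) m.+1 = val (gal2_root h ^+ 2) m.+1.
  have z1 := prim_expr_order zprim; move: gh.
  rewrite (gal2_char g z1) (gal2_char h z1) => /eqP.
  rewrite (eq_prim_root_expr zprim) !modn_small ?z2_lt // => /eqP e.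
  exact: val_inj.
have auteq v : gal2_aut g (f v) = gal2_aut h (f v).
  have [->|/valN[j [z [q [jN zj ->]]]]] := eqVneq (f v) 0; first by rewrite !rmorph0.
  have z1 : z ^+ (2 ^ m.+2) = 1.
    have /subnKC <- : (j <= m.+2)%N by rewrite /m; lia.
    by rewrite expnD exprM (prim_expr_order zj) expr1n.
  have homE (k : gal2) : gal2_aut k (map_poly iota q).[z] =
      (map_poly iota q).[z ^+ val (gal2_root k ^+ 2) m.+1].
    rewrite -horner_map -map_poly_comp -(gal2_char k z1); congr (_.[_]).
    by apply: eq_map_poly => a /=; apply: (gal2_galois k).2.
  by rewrite !homE chareq.
have dilm t v : f v != 0 -> f (emb (1 + 2 ^+ m.+1 * t) *: v) = f v.
  by rewrite (_ : m.+1 = n + N.+1)%N ?exprD -?mulrA; [apply: dil|rewrite /m; lia].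
(* Dilation invariance is available only where f is nonzero, so this one-sided form is applied in
   both directions. *)
have half (g1 g2 : gal2) v : val (gal2_root g1 ^+ 2) m.+1 = val (gal2_root g2 ^+ 2) m.+1 ->
    f ((emb (gal2_root g1))^-1 *: v) != 0 ->
    f ((emb (gal2_root g2))^-1 *: v) = f ((emb (gal2_root g1))^-1 *: v).
  move=> e fv; have [t tE] := z2_sqr_inj (gal2_mod4 g1) (gal2_mod4 g2) e.
  rewrite -[RHS](dilm t) // scalerA; congr (f (_ *: v)).
  have e1 : emb (gal2_root g1) = emb (gal2_root g2) * emb (1 + 2 ^+ m.+1 * t).
    by rewrite -rmorphM -tE.
  have := gal2_emb_neq0 F g1; rewrite e1 mulf_eq0 => /norP[_ u0].
  by rewrite invfM mulrCA divff ?mulr1.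
apply/Cc_ext => v; rewrite !twistE auteq; congr (gal2_aut h _).
have [f0|f0] := eqVneq (f ((emb (gal2_root g))^-1 *: v)) 0; last by rewrite (half g h).
have [f1|f1] := eqVneq (f ((emb (gal2_root h))^-1 *: v)) 0; first by rewrite f0 f1.
by rewrite (half h g).
Qed.

Lemma twist_descent (f : S) : exists x, inv_ext (S := twist_family iota V) x = f.
Proof.
have [m level] := twist_finite_level f.
have [zeta zprim] := hK.1 m.+2; have z1 := prim_expr_order zprim.
pose conj z := exists g : gal2, gal2_aut g zeta = z.
pose Z := undup [seq z <- [seq zeta ^+ i | i <- seq.iota 0 (2 ^ m.+2)] | `[< conj z >]].
have ZP z : z \in Z <-> conj z.
  rewrite mem_undup mem_filter; split=> [/andP[/asboolP]|cz] //.
  apply/andP; split; first exact/asboolP.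
  case: cz => g <-; rewrite (gal2_char g z1); apply/mapP.
  by exists (val (gal2_root g ^+ 2) m.+1 : nat); rewrite // mem_iota add0n z2_lt.
(* By [level], the twist depends only on the conjugate z of [zeta], so the choice of automorphism is
   immaterial; 0 is a default off the orbit. *)
pose fz z : S := if pselect (conj z) is left h then twist_fun (projT1 (cid h)) f else 0.
have fzE (g : gal2) : fz (gal2_aut g zeta) = twist_fun g f.
  rewrite /fz; case: pselect => [h|[]]; last by exists g.
  by case: (cid h) => g' /= e; apply: level zprim e.
have -> : f = fz zeta by rewrite -[LHS](twist_id iota) -fzE.
apply: (descent_span (S := twist_family iota V) (undup_uniq _ : uniq Z)).
  by apply/ZP; exists (gal2_id iota).
move=> g _ /ZP[h <-]; split; first by apply/ZP; exists (gal2_mul g h).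
have -> : sl_aut g (gal2_aut h zeta) = gal2_aut (gal2_mul g h) zeta by [].
by rewrite !fzE twistM.
Qed.
End TwistSpan.

(** * Commutation of the twists with the Weil representation *)

Section WeilTwist.
Local Open Scope classical_set_scope.
Variables (R0 K : fieldType) (iota : {rmorphism R0 -> K}) (F : fieldExtType Q2).
Variables (psi : smooth_char (adic F) K) (psi_nontrivial : exists x, psi x != 1).
Variables (W : vectType (adic F)) (form : {skew_symmetric W}).
Hypotheses (W_neq0 : (0 < \dim {:W})%N) (hform : is_psymplectic form).
Variables (X Y : {vspace W}) (hXY : polarisation form X Y).
Variables (Mp : topGroupType) (p : {multiplicative Mp -> Sp form}) (eps : Mp).
Hypothesis hMp : nontrivial_double_cover p eps.
Variables (lift : Sp form -> Mp) (hlift : unipotent_lift p X lift).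
Variable omega : rep Mp (Cc (subvs_of Y) K).
Hypothesis homega : weil_rep p eps X lift psi omega.
Local Notation S := (Cc (subvs_of Y) K).
Local Notation rho := (heis_act form psi X).
Local Notation emb := (@adic_emb F).
Local Notation "''[' u , v ]" := (form u%R v%R) : ring_scope.

(** The factor u^2 coming from psi turns <y / u, x> into <y, u x>, and is shared equally by the two
    arguments of the remaining pairing. *)
Lemma twist_heis (g : gal2 iota) w t (f : S) :
  twist_fun g (rho (w, t) f) =
  rho (emb (gal2_root g) *: w, emb (gal2_root g ^+ 2) * t) (twist_fun g f).
Proof.
apply/Cc_ext => y; rewrite !twistE /= /heis_fun /=.
set u := emb (gal2_root g); have u0 : u != 0 by apply: gal2_emb_neq0.
have u2 : emb (gal2_root g ^+ 2) = u * u by rewrite expr2 rmorphM.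
rewrite !rmorphM !(char_galois psi _ (gal2_char g)) u2 !linearZ /=.
congr (_ * psi _ * gal2_aut g (f _)).
  rewrite mulrDr !linearZl_LR /=; congr (_ + _); last by ring.
  by rewrite -mulrA mulVKf.
by rewrite scalerDr scalerA mulVf // scale1r.
Qed.

Variable g : gal2 iota.

(** Dilation by u commutes with Sp(W), so the conjugate of the twist by omega(x) obeys the same
    Heisenberg relation, and [heis_schur] makes it a multiple of the twist. *)
Lemma twist_weil_up_to_scalar x : exists c, forall f,
  twist_fun g (omega x f) = c *: omega x (twist_fun g f).
Proof.
pose B : {additive S -> S} := omega x^-1%g \o (twist_fun g \o omega x).
have omegaK f : omega x (omega x^-1%g f) = f by rewrite -repM mulgV rep1.
have omegaK' f : omega x^-1%g (omega x f) = f by rewrite -repM mulVg rep1.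
have weil h f : omega x (rho h f) = rho (sp_heis (p x) h) (omega x f).
  by rewrite -(weil_heis homega) omegaK'.
have [|a f|w f|c cP] := @heis_schur _ _ _ X Y K psi hform hXY psi_nontrivial
  (gal2_aut g) (emb (gal2_root g)) B.
- exact: gal2_emb_neq0.
- by rewrite /B /= linearZ twistZ linearZ.
- rewrite /B /= weil twist_heis mulr0; apply: (can_inj omegaK').
  by rewrite omegaK weil omegaK /sp_heis /= linearZ.
exists c => f; rewrite -linearZ /= -[LHS]omegaK; congr (omega x _).
by apply/Cc_ext => y; apply: cP.
Qed.

Lemma twist_weil x f : twist_fun g (omega x f) = omega x (twist_fun g f).
Proof.
pose D x := forall f, twist_fun g (omega x f) = omega x (twist_fun g f).
have DM a b : D a -> D b -> D (a * b)%g by move=> Da Db h; rewrite !repM Da Db.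
(* The scalar produced by passing [a] is absorbed on passing its inverse. *)
have DJ a b : D b -> D (a * b * a^-1)%g.
  move=> Db h; have [c cP] := twist_weil_up_to_scalar a.
  have e : omega a^-1%g (twist_fun g h) = c *: twist_fun g (omega a^-1%g h).
    have {1}-> : h = omega a (omega a^-1%g h) by rewrite -repM mulgV rep1.
    by rewrite cP linearZ /= -repM mulVg rep1.
  by rewrite !repM cP Db e !linearZ.
have D1 a : p a = 1%g -> D a.
  case/(cover_ker hMp) => -> h; first by rewrite !rep1.
  by rewrite !(weil_eps homega) raddfN.
(* N(X) acts through psi of a quadratic form in y: the u^2 from the Galois action cancels the two
   factors u^-1 from y / u. *)
have DX n : siegel_unipotent X n -> D (lift n).
  move=> nX h; apply/Cc_ext => y; rewrite twistE !(weil_unipotent homega) // twistE.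
  rewrite rmorphM (char_galois psi _ (gal2_char g)); congr (psi _ * _).
  set u := emb (gal2_root g); have u0 : u != 0 by apply: gal2_emb_neq0.
  rewrite (_ : emb (gal2_root g ^+ 2) = u * u); last by rewrite expr2 rmorphM.
  have -> : vsval (u^-1 *: y) = u^-1 *: vsval y by [].
  have -> : n (u^-1 *: vsval y) = u^-1 *: n (vsval y) by rewrite linearZ.
  rewrite -scalerBr linearZl_LR linearZr_LR /=.
  by rewrite mulrCA -[u * u * _]mulrA !mulVKf.
suff Cx : forall z a, p a = z -> D a by apply: (Cx (p x)).
have pV a : p a^-1%g = (p a)^-1%g.
  symmetry; apply: mulg1_eq; rewrite -gmulfM mulgV.
  by apply/(cover_ker hMp); left.
have [pl lM] := hlift; have [Xlag _ _ _] := hXY.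
(* Quantifying over all lifts gives a condition on Sp(W); two lifts differ by the kernel of [p],
   which acts by 1 or -1 and commutes with the twist. *)
apply: (normal_siegel_full hform Xlag W_neq0 (C := fun z => forall a, p a = z -> D a)).
- exact: D1.
- move=> z z' Cz Cz' a pa; have [b pb] := cover_surj hMp z.
  rewrite -(mulVKg b a); apply: DM; first exact: Cz.
  by apply: Cz'; rewrite gmulfM pV pa pb mulKg.
- move=> z z' Cz' a pa; have [b pb] := cover_surj hMp z.
  rewrite (_ : a = b * (b^-1 * a * b) * b^-1)%g; last by rewrite !mulgA mulgV mul1g mulgK.
  by apply/DJ/Cz'; rewrite !gmulfM pV pa pb !mulgA mulVg mul1g divgK.
- move=> n nX a pa; rewrite -(mulVKg (lift n) a); apply: DM; first exact: DX.
  by apply: D1; rewrite gmulfM pV pa pl // mulVg.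
Qed.
End WeilTwist.

Theorem theorem8p1
    (* coefficients: K = R0[zeta_(2^oo)] *)
    (R0 : fieldType) (hR0 : Q_or_Fl R0)
    (K : fieldType) (iota : {rmorphism R0 -> K}) (hK : cyclotomic_tower iota)
    (* F is a finite extension of Q_2 *)
    (F : fieldExtType Q2)
    (psi : smooth_char (adic F) K) (hpsi : exists x, psi x != 1)
    (W : vectType (adic F)) (form : {skew_symmetric W})
    (hW : (0 < \dim {:W})%N) (hform : is_psymplectic form)
    (X Y : {vspace W}) (hXY : polarisation form X Y)
    (Mp : topGroupType) (p : {multiplicative Mp -> Sp form}) (eps : Mp)
    (hMp : nontrivial_double_cover p eps)
    (lift : Sp form -> Mp) (hlift : unipotent_lift p X lift)
    (omega : rep Mp (Cc (subvs_of Y) K))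
    (homega : weil_rep p eps X lift psi omega) :
  exists (V : lmodType (fixedL iota)) (r : rep Mp V),
    smooth_rep r /\
    rep_iso (tens_rep (val : {rmorphism fixedL iota -> K}) r) omega.
Proof.
pose commute (g : sl_index (twist_family iota (subvs_of Y))) x f :
    sl_act g (omega x f) = omega x (sl_act g f) :=
  twist_weil hpsi hW hform hXY hMp hlift homega g x f.
exists (invariants (twist_family iota (subvs_of Y))), (inv_rep commute); split.
  exact/inv_rep_smooth/(weil_smooth homega).
exact/inv_rep_iso/twist_descent.
Qed.
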